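(* Suppose the spectral values of $\mathcal{L}$ satisfy: for all $\sigma,\sigma'\in\mathrm{Spec}(\mathcal{L})$, $\mathrm{Re}(\sigma)=\mathrm{Re}(\sigma')$ implies $\sigma=\sigma'$. Let $u$ be a solution of $\mathcal{L}u=0$ in $A(0,R)=(0,R)\times\mathbb{S}^1$ that has finite order along $S_0=\{0\}\times\mathbb{S}^1$, and suppose there is a sequence $(r_k,t_k)\in A(0,R)$ with $r_k\to0$ and $u(r_k,t_k)=0$ for all $k$. Then $u\equiv0$.
   Context: Fix $a>0$, $b\in\mathbb{R}\setminus\{0\}$, $\lambda=a+ib$, $\nu\in[0,1)$, an integer $k\ge2$ and $c\in C^k(\mathbb{S}^1,\mathbb{C})$. On $(0,\infty)\times\mathbb{S}^1$ (coordinates $(r,t)$) let $\mathcal{L}u=\lambda u_t-iru_r+i\lambda\nu u-c(t)\bar u$. A basic solution of $\mathcal{L}$ is a nontrivial solution of $\mathcal{L}w=0$ on $(0,\infty)\times\mathbb{S}^1$ of the form $w=r^\sigma\phi(t)+\overline{r^\sigma\psi(t)}$, $\sigma\in\mathbb{C}$, $\phi,\psi$ $2\pi$-periodic, written with $|\phi|>|\psi|$ when $\sigma\notin\mathbb{R}$ and as $r^\sigma f$ when $\sigma\in\mathbb{R}$; $\sigma$ is its exponent, and $\mathrm{Spec}(\mathcal{L})$ is the set of exponents. For each $j\in\mathbb{Z}$ there are exactly two $\mathbb{R}$-independent basic solutions $w_j^\pm$ with winding number $j$ and exponents $\sigma_j^\pm$, and every solution $u$ of $\mathcal{L}u=0$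 in $A(0,R)$ admits a convergent expansion $u=\sum_{j\in\mathbb{Z}}(a_j^+w_j^++a_j^-w_j^-)$ with $a_j^\pm\in\mathbb{R}$ (Laurent expansion). $u$ has finite order along $S_0$ if there is $s\in\mathbb{R}$ such that in its Laurent expansion $a_j^\pm=0$ whenever $\mathrm{Re}(\sigma_j^\pm)<s$. *)

(* Defs.v *)
From Stdlib Require Import Reals ZArith Lra.
Open Scope R_scope.

Definition Cx : Type := (R * R)%type.
Definition C0 : Cx := (0, 0).
Definition Ci : Cx := (0, 1).
Definition RtoC (x : R) : Cx := (x, 0).
Definition Cadd (z w : Cx) : Cx := (fst z + fst w, snd z + snd w).
Definition Copp (z : Cx) : Cx := (- fst z, - snd z).
Definition Csub (z w : Cx) : Cx := Cadd z (Copp w).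
Definition Cmul (z w : Cx) : Cx :=
  (fst z * fst w - snd z * snd w, fst z * snd w + snd z * fst w).
Definition Cconj (z : Cx) : Cx := (fst z, - snd z).
Definition Cnorm (z : Cx) : R := sqrt (fst z * fst z + snd z * snd z).
Definition Cscal (x : R) (z : Cx) : Cx := (x * fst z, x * snd z).

(* r^sigma = exp(sigma ln r) for r > 0 *)
Definition Cpow (r : R) (s : Cx) : Cx :=
  (Rpower r (fst s) * cos (snd s * ln r), Rpower r (fst s) * sin (snd s * ln r)).

Definition HasDerivC (f : R -> Cx) (x : R) (l : Cx) : Prop :=
  derivable_pt_lim (fun y => fst (f y)) x (fst l) /\
  derivable_pt_lim (fun y => snd (f y)) x (snd l).

(* 2*pi-periodic functions = functions on S^1 *)
Definition Periodic (f : R -> Cx) : Prop := forall t, f (t + 2 * PI) = f t.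

Definition CkR (k : nat) (f : R -> R) : Prop :=
  exists D : nat -> R -> R,
    (forall x, D 0%nat x = f x) /\
    (forall m x, (m < k)%nat -> derivable_pt_lim (D m) x (D (S m) x)) /\
    continuity (D k).
Definition CkC (k : nat) (c : R -> Cx) : Prop :=
  CkR k (fun t => fst (c t)) /\ CkR k (fun t => snd (c t)).

Definition Lop (lam : Cx) (nu : R) (c : R -> Cx) (u ur ut : Cx) (r t : R) : Cx :=
  Cadd (Csub (Cmul lam ut) (Cmul Ci (Cscal r ur)))
       (Csub (Cmul Ci (Cscal nu (Cmul lam u))) (Cmul (c t) (Cconj u))).

(* u is a (classical) solution of L u = 0 on dom x S^1 (dom an open set of radii) *)
Definition IsSolution (lam : Cx) (nu : R) (c : R -> Cx) (dom : R -> Prop)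
    (u : R -> R -> Cx) : Prop :=
  (forall r t, dom r -> u r (t + 2 * PI) = u r t) /\
  (forall r t, dom r -> forall eps, 0 < eps -> exists delta, 0 < delta /\
      forall r' t', dom r' -> Rabs (r' - r) < delta -> Rabs (t' - t) < delta ->
        Cnorm (Csub (u r' t') (u r t)) < eps) /\
  exists ur ut : R -> R -> Cx, forall r t, dom r ->
    HasDerivC (fun s => u s t) r (ur r t) /\
    HasDerivC (fun s => u r s) t (ut r t) /\
    Lop lam nu c (u r t) (ur r t) (ut r t) r t = C0.

Definition IsBasic (lam : Cx) (nu : R) (c : R -> Cx) (w : R -> R -> Cx) (s : Cx) : Prop :=
  IsSolution lam nu c (fun r => 0 < r) w /\
  (exists r t, 0 < r /\ w r t <> C0) /\
  exists phi psi : R -> Cx,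
    Periodic phi /\ Periodic psi /\
    (forall r t, 0 < r -> w r t = Cadd (Cmul (Cpow r s) (phi t)) (Cconj (Cmul (Cpow r s) (psi t)))) /\
    (snd s <> 0 -> forall t, Cnorm (psi t) < Cnorm (phi t)) /\
    (snd s = 0 -> forall t, psi t = C0).

Definition InSpec (lam : Cx) (nu : R) (c : R -> Cx) (s : Cx) : Prop :=
  exists w, IsBasic lam nu c w s.

Definition Winding (f : R -> Cx) (j : Z) : Prop :=
  (forall t, f t <> C0) /\
  exists theta : R -> R, continuity theta /\
    (forall t, f t = Cscal (Cnorm (f t)) (cos (theta t), sin (theta t))) /\
    (forall t, theta (t + 2 * PI) = theta t + 2 * PI * IZR j).

Fixpoint SymSum (T : Z -> Cx) (N : nat) : Cx :=
  match N with
  | O => T 0%Z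
  | S n => Cadd (SymSum T n) (Cadd (T (Z.of_nat (S n))) (T (- Z.of_nat (S n))%Z))
  end.

(* Finite order along S_0: u has a Laurent expansion
   u = sum_j (a_j^+ w_j^+ + a_j^- w_j^-) (w_j^true = w_j^+, w_j^false = w_j^-)
   with a_j^pm = 0 whenever Re sigma_j^pm < s. *)
Definition FiniteOrder (lam : Cx) (nu : R) (c : R -> Cx) (Rad : R) (u : R -> R -> Cx) : Prop :=
  exists (W : Z -> bool -> R -> R -> Cx) (Sg : Z -> bool -> Cx) (A : Z -> bool -> R) (s : R),
    (forall j e, IsBasic lam nu c (W j e) (Sg j e) /\ Winding (fun t => W j e 1 t) j) /\
    (forall j (al be : R),
        (forall r t, 0 < r -> Cadd (Cscal al (W j true r t)) (Cscal be (W j false r t)) = C0) ->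
        al = 0 /\ be = 0) /\
    (forall r t, 0 < r < Rad -> forall eps, 0 < eps -> exists N0, forall N, (N0 <= N)%nat ->
        Cnorm (Csub (SymSum (fun j => Cadd (Cscal (A j true) (W j true r t))
                                          (Cscal (A j false) (W j false r t))) N)
                    (u r t)) < eps) /\
    (forall j e, fst (Sg j e) < s -> A j e = 0).

(* Main.v *)
Require Import Defs.
From Stdlib Require Import Reals ZArith List Lra Lia Psatz Classical ClassicalEpsilon.
From Coquelicot Require Import Coquelicot.
Open Scope R_scope.

(** Write [h = c / lam] and [mu = sigma / lam].  A basic solution is governed by
    a nowhere zero function [phi] and a ratio [q] ([psi / phi] for a non-real
    exponent, [conj f / f] for a real one) with [|q| <= 1] and
    [phi' = (i (mu - nu) + h q) phi]; integrating the logarithm over a period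
    gives [|sigma - lam (j + nu)| = O(1)] for winding number [j].  For a
    non-real exponent [q] is a periodic solution in the unit disc of the Riccati
    equation [q' = - i kap q + conj h - h q^2], where [kap] is real affine in
    [sigma].  Hyperbolic geometry shows that [sigma] determines [q], hence [j]
    and [phi] up to a complex factor, and for large [j] a contraction argument
    shows that [j] determines [sigma] and [q].  The last fact turns the pointwise
    convergence of the Laurent series into geometric bounds on its tail.  Finite
    order yields a minimal real part [rho] among the exponents that occur; by the
    spectral hypothesis it belongs to one exponent, whose terms add up to a
    function bounded below by a multiple of [r^rho], whereas the rest of [u] is
    [o(r^rho)].  Hence [u] has no zeros near [r = 0] unless all
    coefficients vanish. *)

(** Finite order supplies a family [W] with arbitrary normalisations, possibly with different
    exponents inside a pair, and the symmetric partial sums converge only pointwise. Convergence at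
    one point bounds the sum of the two terms of a pair, never each term, so a bound can be carried
    to smaller [r] only if the pair is a single function governed by its value at one point. For
    this the two exponents with winding number [j] must coincide when [j] is large, and here
    [b <> 0] enters: [Im sigma] grows like [b j], hence so does [Im kap]. The spectral hypothesis,
    on the other hand, identifies exponents but does not mention winding numbers: several pairs
    might share the leading exponent and cancel. Excluding this needs an argument that also holds
    for small [j], where no contraction is available. The hyperbolic distance provides it for
    non-real exponents, and uniqueness for a real-linear equation for real ones. *)

(** * Periodic real functions and one-variable calculus *)

Definition periodic {A : Type} (f : R -> A) : Prop :=
  forall t, f (t + 2 * PI) = f t.

Lemma periodic_nat {A : Type} (f : R -> A) (n : nat) (t : R) :
  periodic f -> f (t + INR n * (2 * PI)) = f t.
Proof.
  intros Hf; induction n as [|n IH].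
  - f_equal; simpl; ring.
  - rewrite <- IH, <- (Hf (t + INR n * (2 * PI))), S_INR; f_equal; ring.
Qed.

Lemma periodic_Z {A : Type} (f : R -> A) (n : Z) (t : R) :
  periodic f -> f (t + IZR n * (2 * PI)) = f t.
Proof.
  intros Hf; destruct (Z_le_gt_dec 0 n) as [Hn|Hn].
  - rewrite <- (Z2Nat.id n Hn), <- INR_IZR_INZ; now apply periodic_nat.
  - rewrite <- (periodic_nat f (Z.to_nat (- n)) _ Hf), INR_IZR_INZ, Z2Nat.id by lia.
    f_equal; rewrite opp_IZR; ring.
Qed.

Lemma period_reduction (t : R) :
  exists t', 0 <= t' <= 2 * PI /\
    forall (A : Type) (f : R -> A), periodic f -> f t' = f t.
Proof.
  pose proof PI_RGT_0 as Hpi.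
  set (n := Int_part (t / (2 * PI))).
  exists (t + IZR (- n) * (2 * PI)); split.
  - destruct (base_Int_part (t / (2 * PI))) as [H1 H2]; fold n in H1, H2.
    rewrite opp_IZR.
    assert (E : t = t / (2 * PI) * (2 * PI)) by (field; lra).
    set (q := t / (2 * PI)) in *; nra.
  - intros A f Hf; now apply periodic_Z.
Qed.

Lemma periodic_max (f : R -> R) :
  periodic f -> continuity f -> exists t0, forall t, f t <= f t0.
Proof.
  intros Hp Hc; pose proof PI_RGT_0 as Hpi.
  destruct (continuity_ab_maj f 0 (2 * PI)) as [t0 [Ht0 _]];
    [lra | intros; apply Hc |].
  exists t0; intros t.
  destruct (period_reduction t) as [t' [H1 H2]].
  rewrite <- (H2 R f Hp); now apply Ht0.
Qed.

Lemma periodic_min (f : R -> R) :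
  periodic f -> continuity f -> exists t0, forall t, f t0 <= f t.
Proof.
  intros Hp Hc.
  destruct (periodic_max (fun t => - f t)) as [t0 Ht0].
  - intros t; now rewrite Hp.
  - now apply continuity_opp.
  - exists t0; intros t; specialize (Ht0 t); lra.
Qed.

Lemma derivative_at_max (f : R -> R) (t0 l : R) :
  (forall t, f t <= f t0) -> derivable_pt_lim f t0 l -> l = 0.
Proof.
  intros Hmax Hd.
  rewrite <- (derive_pt_eq_0 f t0 l (exist _ l Hd) Hd).
  apply (deriv_maximum f (t0 - 1) (t0 + 1)); try lra; intros; apply Hmax.
Qed.

Lemma mvt_whole (F f : R -> R) (x y : R) :
  (forall t, derivable_pt_lim F t (f t)) ->
  exists z, F y - F x = f z * (y - x).
Proof.
  intros HF.
  destruct (MVT_gen F x y f) as [z [_ Hz]].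
  - intros t _; apply is_derive_Reals, HF.
  - intros t _; apply derivable_continuous_pt; exists (f t); apply HF.
  - now exists z.
Qed.

Lemma primitive_exists (f : R -> R) :
  continuity f -> exists F, F 0 = 0 /\ forall t, derivable_pt_lim F t (f t).
Proof.
  intros Hf.
  assert (Hc : forall x, continuous f x)
    by (intros x; apply continuity_pt_filterlim, Hf).
  exists (fun t => RInt f 0 t); split.
  - apply (RInt_point 0 f).
  - intros t; apply is_derive_Reals, (is_derive_RInt f _ 0); [|apply Hc].
    apply filter_forall; intros s; apply (RInt_correct f), ex_RInt_continuous.
    intros; apply Hc.
Qed.

Lemma continuity_of_derivative (f f' : R -> R) :
  (forall t, derivable_pt_lim f t (f' t)) -> continuity f.
Proof.
  intros H t; apply derivable_continuous_pt; exists (f' t); apply H.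
Qed.

Lemma derivable_pt_lim_eq (f g : R -> R) (x l l' : R) :
  (forall y, f y = g y) -> l = l' -> derivable_pt_lim f x l -> derivable_pt_lim g x l'.
Proof.
  intros Hfg <- H; apply is_derive_Reals.
  apply (is_derive_ext f g); [exact Hfg | now apply is_derive_Reals].
Qed.

(** * Differentiation and continuity of complex-valued functions *)

Lemma HasDerivC_eq (f g : R -> C) (x : R) (l l' : C) :
  (forall y, f y = g y) -> l = l' -> HasDerivC f x l -> HasDerivC g x l'.
Proof.
  intros Hfg Hl [H1 H2]; split.
  - eapply derivable_pt_lim_eq; [|rewrite <- Hl; reflexivity|exact H1].
    intros y; simpl; now rewrite Hfg.
  - eapply derivable_pt_lim_eq; [|rewrite <- Hl; reflexivity|exact H2].
    intros y; simpl; now rewrite Hfg.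
Qed.

Lemma HasDerivC_unique (f : R -> C) (x : R) (l l' : C) :
  HasDerivC f x l -> HasDerivC f x l' -> l = l'.
Proof.
  intros [H1 H2] [H3 H4]; apply injective_projections.
  - exact (uniqueness_limite _ _ _ _ H1 H3).
  - exact (uniqueness_limite _ _ _ _ H2 H4).
Qed.

Lemma HasDerivC_const (z : C) (x : R) : HasDerivC (fun _ => z) x (RtoC 0).
Proof. split; apply derivable_pt_lim_const. Qed.

Lemma HasDerivC_plus (f g : R -> C) (x : R) (l m : C) :
  HasDerivC f x l -> HasDerivC g x m ->
  HasDerivC (fun y => (f y + g y)%C) x (l + m)%C.
Proof.
  intros [H1 H2] [H3 H4]; split.
  - exact (derivable_pt_lim_plus _ _ _ _ _ H1 H3).
  - exact (derivable_pt_lim_plus _ _ _ _ _ H2 H4).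
Qed.

Lemma HasDerivC_conj (f : R -> C) (x : R) (l : C) :
  HasDerivC f x l -> HasDerivC (fun y => Cconj (f y)) x (Cconj l).
Proof.
  intros [H1 H2]; split; [exact H1 | exact (derivable_pt_lim_opp _ _ _ H2)].
Qed.

Lemma HasDerivC_mult (f g : R -> C) (x : R) (l m : C) :
  HasDerivC f x l -> HasDerivC g x m ->
  HasDerivC (fun y => (f y * g y)%C) x (l * g x + f x * m)%C.
Proof.
  intros [H1 H2] [H3 H4]; split.
  - eapply derivable_pt_lim_eq;
      [intros y; reflexivity | |
       exact (derivable_pt_lim_minus _ _ _ _ _
         (derivable_pt_lim_mult _ _ _ _ _ H1 H3)
         (derivable_pt_lim_mult _ _ _ _ _ H2 H4))].
    simpl; ring.
  - eapply derivable_pt_lim_eq;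
      [intros y; reflexivity | |
       exact (derivable_pt_lim_plus _ _ _ _ _
         (derivable_pt_lim_mult _ _ _ _ _ H1 H4)
         (derivable_pt_lim_mult _ _ _ _ _ H2 H3))].
    simpl; ring.
Qed.

Lemma HasDerivC_scale (z : C) (f : R -> C) (x : R) (l : C) :
  HasDerivC f x l -> HasDerivC (fun y => (z * f y)%C) x (z * l)%C.
Proof.
  intros H.
  eapply HasDerivC_eq; [intros y; reflexivity| |
    exact (HasDerivC_mult _ _ _ _ _ (HasDerivC_const z x) H)].
  simpl; ring.
Qed.

Definition sqmod (z : C) : R := fst z * fst z + snd z * snd z.

Lemma sqmod_Cmod (z : C) : sqmod z = Cmod z * Cmod z.
Proof.
  unfold sqmod, Cmod; rewrite sqrt_sqrt; [ring|].
  nra.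
Qed.

Lemma Cnorm_Cmod (z : C) : Cnorm z = Cmod z.
Proof. unfold Cnorm, Cmod; f_equal; ring. Qed.

Lemma sqmod_derivative (f : R -> C) (x : R) (l : C) :
  HasDerivC f x l ->
  derivable_pt_lim (fun y => sqmod (f y)) x (2 * Re (Cconj (f x) * l)%C).
Proof.
  intros [H1 H2].
  eapply derivable_pt_lim_eq;
    [intros y; reflexivity | |
     exact (derivable_pt_lim_plus _ _ _ _ _
       (derivable_pt_lim_mult _ _ _ _ _ H1 H1)
       (derivable_pt_lim_mult _ _ _ _ _ H2 H2))].
  unfold Re, Cconj, Cmult; simpl; ring.
Qed.

Lemma sum_sqr_neq_0 (z : C) : z <> RtoC 0 -> fst z ^ 2 + snd z ^ 2 <> 0.
Proof.
  destruct z as [x y]; simpl; intros Hz H; apply Hz.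
  apply injective_projections; simpl; nra.
Qed.

Lemma HasDerivC_inv (f : R -> C) (x : R) (l : C) :
  f x <> RtoC 0 -> HasDerivC f x l ->
  HasDerivC (fun y => (/ f y)%C) x (- l / (f x * f x))%C.
Proof.
  intros Hf [H1 H2]; pose proof (sum_sqr_neq_0 _ Hf) as Hn.
  assert (HN : derivable_pt_lim (fun y => fst (f y) ^ 2 + snd (f y) ^ 2) x
                 (2 * (fst (f x) * fst l + snd (f x) * snd l))).
  { eapply derivable_pt_lim_eq; [| |
      exact (sqmod_derivative f x l (conj H1 H2))].
    - intros y; unfold sqmod; ring.
    - unfold Re, Cconj, Cmult; simpl; ring. }
  assert (Hn2 : (fst (f x) * fst (f x) - snd (f x) * snd (f x)) ^ 2 +
     (fst (f x) * snd (f x) + snd (f x) * fst (f x)) ^ 2 <> 0).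
  { replace (_ + _) with ((fst (f x) ^ 2 + snd (f x) ^ 2) ^ 2) by ring.
    now apply pow_nonzero. }
  split.
  - eapply derivable_pt_lim_eq; [intros y; reflexivity | |
      exact (derivable_pt_lim_div _ _ _ _ _ H1 HN Hn)].
    unfold Rsqr, Cdiv, Cinv, Cmult, Copp; simpl fst; simpl snd; field;
      split; [intro Hz; apply Hn2; rewrite <- Hz; ring | exact Hn].
  - eapply derivable_pt_lim_eq; [intros y; reflexivity | |
      exact (derivable_pt_lim_div _ _ _ _ _ (derivable_pt_lim_opp _ _ _ H2) HN Hn)].
    unfold Rsqr, opp_fct, Cdiv, Cinv, Cmult, Copp; simpl fst; simpl snd; field;
      split; [intro Hz; apply Hn2; rewrite <- Hz; ring | exact Hn].
Qed.

Lemma HasDerivC_div (f g : R -> C) (x : R) (l m : C) :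
  g x <> RtoC 0 -> HasDerivC f x l -> HasDerivC g x m ->
  HasDerivC (fun y => (f y / g y)%C) x ((l * g x - f x * m) / (g x * g x))%C.
Proof.
  intros Hg Hf Hm.
  eapply HasDerivC_eq; [intros y; reflexivity| |
    exact (HasDerivC_mult _ _ _ _ _ Hf (HasDerivC_inv _ _ _ Hg Hm))].
  simpl; field; auto.
Qed.

Lemma HasDerivC_zero_const (f : R -> C) :
  (forall t, HasDerivC f t (RtoC 0)) -> forall s t, f s = f t.
Proof.
  intros H s t; apply injective_projections.
  - destruct (mvt_whole (fun y => fst (f y)) (fun _ => 0) s t) as [z Hz];
      [intros y; apply H | lra].
  - destruct (mvt_whole (fun y => snd (f y)) (fun _ => 0) s t) as [z Hz];
      [intros y; apply H | lra].
Qed.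

Definition continuousC (f : R -> C) : Prop :=
  continuity (fun t => fst (f t)) /\ continuity (fun t => snd (f t)).

Lemma HasDerivC_continuous (f f' : R -> C) :
  (forall t, HasDerivC f t (f' t)) -> continuousC f.
Proof.
  intros H; split.
  - apply (continuity_of_derivative _ (fun t => fst (f' t))); intros t; apply H.
  - apply (continuity_of_derivative _ (fun t => snd (f' t))); intros t; apply H.
Qed.

Lemma continuousC_mult (f g : R -> C) :
  continuousC f -> continuousC g -> continuousC (fun t => (f t * g t)%C).
Proof.
  intros [H1 H2] [H3 H4]; split; simpl.
  - exact (continuity_minus _ _ (continuity_mult _ _ H1 H3) (continuity_mult _ _ H2 H4)).
  - exact (continuity_plus _ _ (continuity_mult _ _ H1 H4) (continuity_mult _ _ H2 H3)).
Qed.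

Lemma continuousC_plus (f g : R -> C) :
  continuousC f -> continuousC g -> continuousC (fun t => (f t + g t)%C).
Proof.
  intros [H1 H2] [H3 H4]; split; simpl.
  - exact (continuity_plus _ _ H1 H3).
  - exact (continuity_plus _ _ H2 H4).
Qed.

Lemma continuousC_const (z : C) : continuousC (fun _ => z).
Proof. split; apply continuity_const; intros x y; reflexivity. Qed.

Lemma sqmod_continuous (f : R -> C) :
  continuousC f -> continuity (fun t => sqmod (f t)).
Proof.
  intros [H1 H2].
  exact (continuity_plus _ _ (continuity_mult _ _ H1 H1) (continuity_mult _ _ H2 H2)).
Qed.

Lemma Cmod_continuous (f : R -> C) :
  continuousC f -> continuity (fun t => Cmod (f t)).
Proof.
  intros Hf t.
  apply (continuity_pt_ext (fun t => sqrt (sqmod (f t)))).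
  - intros s; rewrite sqmod_Cmod; apply sqrt_square, Cmod_ge_0.
  - apply (continuity_pt_comp (fun t => sqmod (f t)) sqrt).
    + now apply sqmod_continuous.
    + apply continuity_pt_sqrt; unfold sqmod; nra.
Qed.

Lemma im_le_Cmod (z : C) : Rabs (Im z) <= Cmod z.
Proof.
  apply Rle_trans with (2 := Rmax_Cmod z); apply Rmax_r.
Qed.

Lemma Cmod_minus_le_0 (z w : C) : Cmod (z - w)%C <= 0 -> z = w.
Proof.
  intros Hzw; pose proof (Cmod_ge_0 (z - w)%C).
  assert (E : (z - w)%C = RtoC 0) by (apply Cmod_eq_0; lra).
  replace z with ((z - w) + w)%C by ring; rewrite E; ring.
Qed.

Lemma periodic_bounded (f : R -> C) :
  periodic f -> continuousC f -> exists K, 0 < K /\ forall t, Cmod (f t) <= K.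
Proof.
  intros Hp Hc.
  destruct (periodic_max (fun t => Cmod (f t))) as [t0 Ht0].
  - intros t; now rewrite Hp.
  - now apply Cmod_continuous.
  - exists (Cmod (f t0) + 1); split.
    + pose proof (Cmod_ge_0 (f t0)); lra.
    + intros t; specialize (Ht0 t); lra.
Qed.

(** * Profiles: logarithms over a period and the location of [mu] *)

(** No differential equation is imposed on [q]: for a real exponent [q] lies on the unit circle,
    outside the open disc where the Riccati argument works. Integration over a period uses only the
    three conditions on [q] listed here. *)
Record profile (nu : R) (h : R -> C) (mu : C) (phi q : R -> C) : Prop := {
  profile_periodic : periodic phi;
  profile_nonzero : forall t, phi t <> RtoC 0;
  profile_derivative : forall t,
    HasDerivC phi t ((Ci * (mu - nu) + h t * q t) * phi t)%C;
  ratio_periodic : periodic q;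
  ratio_continuous : continuousC q;
  ratio_le_1 : forall t, Cmod (q t) <= 1 }.

Definition cis_exp (x y : R) : C := (exp x * cos y, exp x * sin y).

Lemma cis_exp_inv (x y : R) : (cis_exp x y * cis_exp (- x) (- y))%C = RtoC 1.
Proof.
  unfold cis_exp, Cmult; simpl; rewrite cos_neg, sin_neg, exp_Ropp.
  pose proof (exp_pos x); pose proof (sin2_cos2 y) as Hsc; unfold Rsqr in Hsc.
  apply injective_projections; simpl.
  - field_simplify; [|lra]; rewrite <- Hsc; ring.
  - field; lra.
Qed.

Lemma Cmod_cis_exp (x y : R) : Cmod (cis_exp x y) = exp x.
Proof.
  unfold cis_exp, Cmod; simpl.
  pose proof (exp_pos x); pose proof (sin2_cos2 y) as Hsc; unfold Rsqr in Hsc.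
  replace (_ + _) with (exp x * exp x * (sin y * sin y + cos y * cos y)) by ring.
  rewrite Hsc, Rmult_1_r; apply sqrt_square; lra.
Qed.

Lemma cis_exp_derivative (P1 P2 : R -> R) (t p1 p2 : R) :
  derivable_pt_lim P1 t p1 -> derivable_pt_lim P2 t p2 ->
  HasDerivC (fun s => cis_exp (P1 s) (P2 s)) t ((p1, p2) * cis_exp (P1 t) (P2 t))%C.
Proof.
  intros H1 H2.
  pose proof (derivable_pt_lim_comp _ _ _ _ _ H1 (derivable_pt_lim_exp (P1 t))) as He.
  pose proof (derivable_pt_lim_comp _ _ _ _ _ H2 (derivable_pt_lim_cos (P2 t))) as Hc.
  pose proof (derivable_pt_lim_comp _ _ _ _ _ H2 (derivable_pt_lim_sin (P2 t))) as Hs.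
  split.
  - eapply derivable_pt_lim_eq; [intros y; reflexivity | |
      exact (derivable_pt_lim_mult _ _ _ _ _ He Hc)].
    unfold comp; simpl; ring.
  - eapply derivable_pt_lim_eq; [intros y; reflexivity | |
      exact (derivable_pt_lim_mult _ _ _ _ _ He Hs)].
    unfold comp; simpl; ring.
Qed.

(** A primitive of the logarithmic derivative gives a global logarithm: [phi] times the inverse
    exponential has derivative zero. *)
Lemma profile_logarithm nu h mu phi q :
  continuousC h -> profile nu h mu phi q ->
  exists P1 P2 : R -> R,
    P1 0 = 0 /\ P2 0 = 0 /\
    (forall t, derivable_pt_lim P1 t (Re (Ci * (mu - nu) + h t * q t)%C)) /\
    (forall t, derivable_pt_lim P2 t (Im (Ci * (mu - nu) + h t * q t)%C)) /\
    (forall t, phi t = (phi 0 * cis_exp (P1 t) (P2 t))%C).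
Proof.
  intros Hh Hp.
  destruct (continuousC_plus (fun _ => Ci * (mu - nu))%C (fun t => h t * q t)%C) as [C1 C2].
  { apply continuousC_const. }
  { apply continuousC_mult; [exact Hh | exact (ratio_continuous _ _ _ _ _ Hp)]. }
  destruct (primitive_exists _ C1) as [P1 [P10 HP1]].
  destruct (primitive_exists _ C2) as [P2 [P20 HP2]].
  exists P1, P2; repeat split; auto.
  assert (Hconst : forall t, HasDerivC (fun s => phi s * cis_exp (- P1 s) (- P2 s))%C t (RtoC 0)).
  { intros t.
    eapply HasDerivC_eq; [intros y; reflexivity | |
      exact (HasDerivC_mult _ _ _ _ _ (profile_derivative _ _ _ _ _ Hp t)
        (cis_exp_derivative (fun s => - P1 s) (fun s => - P2 s) _ _ _
           (derivable_pt_lim_opp _ _ _ (HP1 t)) (derivable_pt_lim_opp _ _ _ (HP2 t))))].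
    set (z := (Ci * (mu - nu) + h t * q t)%C).
    replace (- fst z, - snd z) with (- z)%C by reflexivity.
    simpl; ring. }
  intros t.
  pose proof (HasDerivC_zero_const _ Hconst t 0) as E; simpl in E.
  rewrite P10, P20 in E.
  replace (cis_exp (- 0) (- 0)) with (RtoC 1) in E.
  2:{ unfold cis_exp; rewrite Ropp_0, exp_0, cos_0, sin_0.
      apply injective_projections; simpl; ring. }
  rewrite Cmult_1_r in E; rewrite <- E.
  rewrite <- Cmult_assoc, (Cmult_comm (cis_exp (- _) _)), cis_exp_inv; ring.
Qed.

Lemma quasiperiodic_iter (D : R -> R) (e : R) :
  (forall t, D (t + 2 * PI) = D t + e) ->
  forall n, D (INR n * (2 * PI)) = D 0 + INR n * e.
Proof.
  intros H; induction n as [|n IH].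
  - simpl; rewrite !Rmult_0_l; lra.
  - rewrite S_INR.
    replace ((INR n + 1) * (2 * PI)) with (INR n * (2 * PI) + 2 * PI) by ring.
    rewrite H, IH; ring.
Qed.

(** A nonzero drift [e] per period takes [D] arbitrarily far along multiples of [2 * PI], and the
    intermediate value theorem does the rest. The values [PI] and [PI / 2] of [y] serve to
    contradict the drift of an angle. *)
Lemma quasiperiodic_reaches (D : R -> R) (e : R) :
  continuity D -> (forall t, D (t + 2 * PI) = D t + e) -> e <> 0 ->
  forall y, 0 <= y -> exists t, Rabs (D t - D 0) = y.
Proof.
  intros Hc Hq He y Hy.
  pose proof (Rabs_pos_lt e He) as Hpos.
  destruct (INR_unbounded (y / Rabs e)) as [n Hn].
  assert (Hn' : y < INR n * Rabs e).
  { apply (Rmult_lt_compat_r _ _ _ Hpos) in Hn; unfold Rdiv in Hn.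
    rewrite Rmult_assoc, Rinv_l in Hn; lra. }
  pose proof (quasiperiodic_iter D e Hq n) as Hit.
  destruct (IVT_gen (fun t => Rabs (D t - D 0)) 0 (INR n * (2 * PI)) y) as [t [_ Ht]].
  - intros t; apply (continuity_pt_comp (fun t => D t - D 0) Rabs); [|apply Rcontinuity_abs].
    apply (continuity_minus D (fun _ => D 0)); [exact Hc | apply continuity_const; now intros ? ?].
  - rewrite Hit; replace (D 0 + INR n * e - D 0) with (INR n * e) by ring.
    rewrite Rminus_diag, Rabs_R0, Rabs_mult, (Rabs_pos_eq (INR n)) by apply pos_INR.
    rewrite Rmin_left, Rmax_right; lra.
  - now exists t.
Qed.

(** The winding number is known for [f], not for [phi]. Positivity of [Re (f conj phi)] keeps the
    angle between them below a quarter turn, so their arguments cannot drift apart: a drift would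
    somewhere shift the angle difference by [PI] and reverse the sign of this quantity. *)
Lemma profile_logarithm_period nu h mu phi q f j :
  continuousC h -> periodic h -> profile nu h mu phi q ->
  Winding f j -> (forall t, 0 < Re (f t * Cconj (phi t))%C) ->
  exists P1 P2 : R -> R,
    P1 0 = 0 /\ P2 0 = 0 /\ P1 (2 * PI) = 0 /\ P2 (2 * PI) = 2 * PI * IZR j /\
    (forall t, derivable_pt_lim P1 t (Re (Ci * (mu - nu) + h t * q t)%C)) /\
    (forall t, derivable_pt_lim P2 t (Im (Ci * (mu - nu) + h t * q t)%C)) /\
    (forall t, phi t = (phi 0 * cis_exp (P1 t) (P2 t))%C).
Proof.
  intros Hh Hhp Hp [Hf0 [th [Hth [Hf Hj]]]] Hpos.
  destruct (profile_logarithm _ _ _ _ _ Hh Hp) as (P1 & P2 & P10 & P20 & D1 & D2 & E).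
  exists P1, P2; repeat split; auto.
  - assert (Hphi0 := proj1 (Cmod_gt_0 _) (profile_nonzero _ _ _ _ _ Hp 0)).
    pose proof (f_equal Cmod (E (2 * PI))) as E2.
    replace (2 * PI) with (0 + 2 * PI) in E2 at 1 by ring.
    rewrite (profile_periodic _ _ _ _ _ Hp), Cmod_mult, Cmod_cis_exp in E2.
    apply exp_inv; rewrite exp_0; nra.
  - destruct (Req_dec (P2 (2 * PI)) (2 * PI * IZR j)) as [?|Hne]; [assumption|exfalso].
    set (D := fun t => th t - P2 t).
    assert (HP2 : forall t, P2 (t + 2 * PI) = P2 t + P2 (2 * PI)).
    { intros t.
      assert (HD : forall s, derivable_pt_lim (fun s => P2 (s + 2 * PI) - P2 s) s 0).
      { intros s.
        replace 0 with (Im (Ci * (mu - nu) + h (s + 2 * PI)%R * q (s + 2 * PI)%R)%C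
                        - Im (Ci * (mu - nu) + h s * q s)%C).
        2:{ rewrite Hhp, (ratio_periodic _ _ _ _ _ Hp); ring. }
        apply (derivable_pt_lim_minus (fun s => P2 (s + 2 * PI)) P2); [|apply D2].
        apply is_derive_Reals.
        rewrite <- (Rmult_1_l (Im _)).
        apply (is_derive_comp P2 (fun s => s + 2 * PI)).
        - apply is_derive_Reals, D2.
        - auto_derive; auto; ring. }
      destruct (mvt_whole _ (fun _ => 0) 0 t HD) as [z Hz].
      rewrite Rplus_0_l, P20 in Hz; lra. }
    assert (HDq : forall t, D (t + 2 * PI) = D t + (2 * PI * IZR j - P2 (2 * PI))).
    { intros t; unfold D; rewrite Hj, HP2; ring. }
    assert (HDc : continuity D).
    { apply (continuity_minus th P2); [exact Hth|].
      now apply (continuity_of_derivative _ _ D2). }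
    destruct (quasiperiodic_reaches D _ HDc HDq ltac:(lra) PI) as [t Ht];
      [pose proof PI_RGT_0; lra|].
    assert (HR : forall s, 0 < fst (phi 0) * cos (D s) + snd (phi 0) * sin (D s)).
    { intros s; specialize (Hpos s); rewrite (Hf s), (E s), Cnorm_Cmod in Hpos.
      replace (Re _) with (Cmod (f s) * exp (P1 s) *
        (fst (phi 0) * cos (D s) + snd (phi 0) * sin (D s))) in Hpos.
      2:{ unfold D; rewrite cos_minus, sin_minus.
          unfold Re, Cconj, Cmult, Cscal, cis_exp; simpl; ring. }
      assert (0 < Cmod (f s) * exp (P1 s)).
      { apply Rmult_lt_0_compat; [apply Cmod_gt_0, Hf0 | apply exp_pos]. }
      apply (Rmult_lt_reg_l (Cmod (f s) * exp (P1 s))); lra. }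
    pose proof (HR 0) as H0; pose proof (HR t) as H1.
    assert (Hct : cos (D t) = - cos (D 0) /\ sin (D t) = - sin (D 0)).
    { unfold Rabs in Ht; destruct (Rcase_abs (D t - D 0)).
      - replace (D 0) with (D t + PI) by lra.
        rewrite neg_cos, neg_sin; lra.
      - replace (D t) with (D 0 + PI) by lra.
        rewrite neg_cos, neg_sin; lra. }
    destruct Hct as [-> ->] in H1; lra.
Qed.

(* The total increment of the logarithm over a period is [2 i pi j], so the
   mean value theorem locates [mu]. *)
Lemma mu_location nu h mu phi q f j G :
  continuousC h -> periodic h -> (forall t, Cmod (h t) <= G) ->
  profile nu h mu phi q ->
  Winding f j -> (forall t, 0 < Re (f t * Cconj (phi t))%C) ->
  Rabs (Im mu) <= G /\ Rabs (Re mu - nu - IZR j) <= G.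
Proof.
  intros Hh Hhp HG Hp Hw Hpos; pose proof PI_RGT_0 as Hpi.
  destruct (profile_logarithm_period _ _ _ _ _ _ _ Hh Hhp Hp Hw Hpos)
    as (P1 & P2 & P10 & P20 & P11 & P21 & D1 & D2 & _).
  assert (Hb : forall t, Cmod (h t * q t)%C <= G).
  { intros t; rewrite Cmod_mult.
    pose proof (ratio_le_1 _ _ _ _ _ Hp t); pose proof (Cmod_ge_0 (q t)).
    pose proof (Cmod_ge_0 (h t)); specialize (HG t); nra. }
  split.
  - destruct (mvt_whole _ _ 0 (2 * PI) D1) as [z Hz].
    pose proof (re_le_Cmod (h z * q z)%C) as Hr; specialize (Hb z).
    assert (Hz0 : Re (Ci * (mu - nu) + h z * q z)%C = 0) by nra.
    rewrite re_plus in Hz0.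
    replace (Im mu) with (Re (h z * q z)%C); [lra|].
    replace (Re (Ci * (mu - nu))%C) with (- Im mu) in Hz0; [lra|].
    unfold Re, Im; simpl; ring.
  - destruct (mvt_whole _ _ 0 (2 * PI) D2) as [z Hz].
    pose proof (im_le_Cmod (h z * q z)%C) as Hr; specialize (Hb z).
    assert (Hz0 : Im (Ci * (mu - nu) + h z * q z)%C = IZR j) by nra.
    rewrite im_plus in Hz0.
    replace (Re mu - nu - IZR j) with (- Im (h z * q z)%C); [rewrite Rabs_Ropp; lra|].
    replace (Im (Ci * (mu - nu))%C) with (Re mu - nu) in Hz0; [lra|].
    unfold Re, Im; simpl; ring.
Qed.

(** Subtracting the logarithms before applying the mean value theorem leaves only [h (q - q')], so
    the error is proportional to the distance of the ratios. This is the half of the contraction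
    that leads from [q] to [mu]; with [d = 0] it also shows that [mu] and [q] together determine the
    winding number. *)
Lemma mu_comparison nu h mu mu' phi phi' q q' f f' j j' G d :
  continuousC h -> periodic h -> (forall t, Cmod (h t) <= G) ->
  profile nu h mu phi q -> profile nu h mu' phi' q' ->
  Winding f j -> (forall t, 0 < Re (f t * Cconj (phi t))%C) ->
  Winding f' j' -> (forall t, 0 < Re (f' t * Cconj (phi' t))%C) ->
  (forall t, Cmod (q t - q' t)%C <= d) ->
  Rabs (Im (mu - mu')%C) <= G * d /\
  Rabs (Re (mu - mu')%C - (IZR j - IZR j')) <= G * d.
Proof.
  intros Hh Hhp HG Hp Hp' Hw Hpos Hw' Hpos' Hd; pose proof PI_RGT_0 as Hpi.
  destruct (profile_logarithm_period _ _ _ _ _ _ _ Hh Hhp Hp Hw Hpos)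
    as (P1 & P2 & P10 & P20 & P11 & P21 & D1 & D2 & _).
  destruct (profile_logarithm_period _ _ _ _ _ _ _ Hh Hhp Hp' Hw' Hpos')
    as (P1' & P2' & P10' & P20' & P11' & P21' & D1' & D2' & _).
  assert (Hb : forall t, Cmod (h t * (q t - q' t))%C <= G * d).
  { intros t; rewrite Cmod_mult.
    apply Rmult_le_compat; try apply Cmod_ge_0; auto. }
  split.
  - destruct (mvt_whole (fun t => P1 t - P1' t) _ 0 (2 * PI)
      (fun t => derivable_pt_lim_minus _ _ _ _ _ (D1 t) (D1' t))) as [z Hz].
    pose proof (re_le_Cmod (h z * (q z - q' z))%C) as Hr; specialize (Hb z).
    cbv beta in Hz; rewrite P10, P11, P10', P11' in Hz.
    replace (Im (mu - mu')%C) with (Re (h z * (q z - q' z))%C); [lra|].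
    assert (Re (Ci * (mu - nu) + h z * q z)%C - Re (Ci * (mu' - nu) + h z * q' z)%C = 0) by nra.
    unfold Re, Im in *; simpl in *; lra.
  - destruct (mvt_whole (fun t => P2 t - P2' t) _ 0 (2 * PI)
      (fun t => derivable_pt_lim_minus _ _ _ _ _ (D2 t) (D2' t))) as [z Hz].
    pose proof (im_le_Cmod (h z * (q z - q' z))%C) as Hr; specialize (Hb z).
    cbv beta in Hz; rewrite P20, P21, P20', P21' in Hz.
    assert (Im (Ci * (mu - nu) + h z * q z)%C - Im (Ci * (mu' - nu) + h z * q' z)%C
            = IZR j - IZR j') by nra.
    replace (Re (mu - mu')%C - (IZR j - IZR j')) with (- Im (h z * (q z - q' z))%C);
      [rewrite Rabs_Ropp; lra|].
    unfold Re, Im in *; simpl in *; lra.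
Qed.

(** For given [mu] and [q] the equation of [phi] is complex linear of first order, so the quotient
    of two solutions is constant. *)
Lemma profile_proportional nu h mu phi phi' q q' :
  profile nu h mu phi q -> profile nu h mu phi' q' -> (forall t, q' t = q t) ->
  exists z, forall t, phi' t = (z * phi t)%C.
Proof.
  intros Hp Hp' Hq; exists (phi' 0 / phi 0)%C; intros t.
  assert (Hz : forall s, HasDerivC (fun s => phi' s / phi s)%C s (RtoC 0)).
  { intros s; pose proof (profile_nonzero _ _ _ _ _ Hp s) as Hnz.
    eapply HasDerivC_eq; [intros y; reflexivity | |
      exact (HasDerivC_div _ _ _ _ _ Hnz (profile_derivative _ _ _ _ _ Hp' s)
               (profile_derivative _ _ _ _ _ Hp s))].
    simpl; rewrite Hq; field; auto. }
  rewrite <- (HasDerivC_zero_const _ Hz t 0); field; apply (profile_nonzero _ _ _ _ _ Hp).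
Qed.

(** The derivative of [ln |phi|] is at most [|Im mu| + |h q| <= 2 G], and at most one period of
    length [2 * PI] is crossed. The point is that the constant does not depend on the winding
    number. *)
Lemma profile_harnack nu h mu phi q G t :
  continuousC h -> (forall t, Cmod (h t) <= G) -> profile nu h mu phi q ->
  Rabs (Im mu) <= G -> Cmod (phi t) <= exp (4 * PI * G) * Cmod (phi 0).
Proof.
  intros Hh HG Hp Hmu; pose proof PI_RGT_0 as Hpi.
  destruct (period_reduction t) as [t' [Ht' Hper]].
  rewrite <- (Hper _ phi (profile_periodic _ _ _ _ _ Hp)).
  destruct (profile_logarithm _ _ _ _ _ Hh Hp) as (P1 & P2 & P10 & P20 & D1 & D2 & E).
  rewrite (E t'), Cmod_mult, Cmod_cis_exp, Rmult_comm.
  apply Rmult_le_compat_r; [apply Cmod_ge_0|].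
  assert (Hle : P1 t' <= 4 * PI * G).
  { destruct (mvt_whole _ _ 0 t' D1) as [z Hz].
    rewrite P10, re_plus in Hz.
    pose proof (re_le_Cmod (h z * q z)%C) as Hr; rewrite Cmod_mult in Hr.
    pose proof (ratio_le_1 _ _ _ _ _ Hp z); pose proof (Cmod_ge_0 (q z)).
    pose proof (Cmod_ge_0 (h z)); specialize (HG z).
    replace (Re (Ci * (mu - nu))%C) with (- Im mu) in Hz by (unfold Re, Im; simpl; ring).
    apply Rabs_le_between in Hmu; apply Rabs_le_between in Hr.
    assert (- Im mu + Re (h z * q z)%C <= 2 * G) by nra.
    assert (0 <= G) by lra.
    apply Rle_trans with (2 * G * t'); nra. }
  destruct Hle as [Hlt| ->]; [left; now apply exp_increasing | right; reflexivity].
Qed.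

(** * Periodic solutions of the Riccati equation in the unit disc *)

Definition riccati (kap : C) (h q : R -> C) : Prop :=
  forall t, HasDerivC q t (- Ci * kap * q t + Cconj (h t) - h t * q t * q t)%C.

(* The part of the Riccati field independent of [Im kap] is an infinitesimal
   isometry of the hyperbolic disc, and the remaining radial field
   [(Im kap) q] moves any two points strictly apart or strictly together. *)
Lemma riccati_periodic_unique kap h q1 q2 :
  riccati kap h q1 -> riccati kap h q2 -> periodic q1 -> periodic q2 ->
  (forall t, Cmod (q1 t) < 1) -> (forall t, Cmod (q2 t) < 1) -> Im kap <> 0 ->
  forall t, q1 t = q2 t.
Proof.
  intros R1 R2 p1 p2 B1 B2 Hk.
  assert (S1 : forall t, sqmod (q1 t) < 1).
  { intros t; rewrite sqmod_Cmod; specialize (B1 t); pose proof (Cmod_ge_0 (q1 t)); nra. }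
  assert (S2 : forall t, sqmod (q2 t) < 1).
  { intros t; rewrite sqmod_Cmod; specialize (B2 t); pose proof (Cmod_ge_0 (q2 t)); nra. }
  (* [N / D] is [sinh^2] of half the hyperbolic distance between [q1] and [q2]; being periodic, it
     attains its maximum. *)
  set (N := fun t => sqmod (q1 t - q2 t)%C).
  set (D := fun t => (1 - sqmod (q1 t)) * (1 - sqmod (q2 t))).
  assert (HD : forall t, 0 < D t).
  { intros t; specialize (S1 t); specialize (S2 t); apply Rmult_lt_0_compat; lra. }
  assert (Nd : forall t, derivable_pt_lim N t
    (2 * Re (Cconj (q1 t - q2 t) * ((- Ci * kap * q1 t + Cconj (h t) - h t * q1 t * q1 t)
      + - RtoC 1 * (- Ci * kap * q2 t + Cconj (h t) - h t * q2 t * q2 t)))%C)).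
  { intros t.
    pose proof (HasDerivC_plus _ _ _ _ _ (R1 t) (HasDerivC_scale (- RtoC 1)%C _ _ _ (R2 t))) as Hd.
    eapply derivable_pt_lim_eq; [| | exact (sqmod_derivative _ _ _ Hd)].
    - intros y; unfold N, sqmod; simpl; ring.
    - simpl; ring. }
  assert (Dd : forall t, derivable_pt_lim D t
    ((0 - 2 * Re (Cconj (q1 t) * (- Ci * kap * q1 t + Cconj (h t) - h t * q1 t * q1 t))%C)
       * (1 - sqmod (q2 t))
     + (1 - sqmod (q1 t)) *
     (0 - 2 * Re (Cconj (q2 t) * (- Ci * kap * q2 t + Cconj (h t) - h t * q2 t * q2 t))%C))).
  { intros t.
    apply (derivable_pt_lim_mult (fun t => 1 - sqmod (q1 t)) (fun t => 1 - sqmod (q2 t))).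
    - apply (derivable_pt_lim_minus (fun _ => 1) (fun t => sqmod (q1 t)));
        [apply derivable_pt_lim_const | apply sqmod_derivative, R1].
    - apply (derivable_pt_lim_minus (fun _ => 1) (fun t => sqmod (q2 t)));
        [apply derivable_pt_lim_const | apply sqmod_derivative, R2]. }
  pose proof (fun t => derivable_pt_lim_div N D t _ _ (Nd t) (Dd t)
    (Rgt_not_eq _ _ (HD t))) as Hd.
  destruct (periodic_max (fun t => N t / D t)) as [t0 Ht0].
  { intros t; unfold N, D; now rewrite p1, p2. }
  { exact (continuity_of_derivative _ _ Hd). }
  pose proof (derivative_at_max _ _ _ Ht0 (Hd t0)) as Hz.
  assert (HN0 : N t0 = 0).
  { pose proof (HD t0) as HDt.
    (* The numerator of the derivative of [N / D] reduces to this product, as [h] and [Re kap]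
       cancel. Its last factor is positive inside the disc, so [N] vanishes at the maximum. *)
    assert (E : 2 * Im kap * N t0 * (1 - sqmod (q1 t0) * sqmod (q2 t0)) = 0).
    { apply (Rmult_eq_reg_r (/ (D t0)²)).
      2:{ apply Rinv_neq_0_compat; unfold Rsqr; nra. }
      rewrite Rmult_0_l, <- Hz; unfold Rdiv; apply Rmult_eq_compat_r.
      unfold N, D, sqmod, Re, Im; simpl; ring. }
    apply Rmult_integral in E; destruct E as [E|E].
    - apply Rmult_integral in E; destruct E as [E|E]; [lra | exact E].
    - exfalso; specialize (S1 t0); specialize (S2 t0).
      assert (0 <= sqmod (q1 t0)) by (unfold sqmod; nra).
      assert (0 <= sqmod (q2 t0)) by (unfold sqmod; nra); nra. }
  intros t; specialize (Ht0 t); cbv beta in Ht0.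
  rewrite HN0 in Ht0; unfold Rdiv at 2 in Ht0; rewrite Rmult_0_l in Ht0.
  assert (Hle : N t <= 0).
  { specialize (HD t); replace (N t) with (N t / D t * D t) by (field; lra); nra. }
  assert (Hsq : Cmod (q1 t - q2 t)%C * Cmod (q1 t - q2 t)%C <= 0)
    by (rewrite <- sqmod_Cmod; exact Hle).
  apply Cmod_minus_le_0; nra.
Qed.

(** At a maximum of [|f|^2] its derivative vanishes. There the term in [kap] contributes
    [2 Im kap |f|^2], which the terms in [v] and [w] have to balance. The estimate is applied to a
    solution [q] and to the difference of two solutions. *)
Lemma periodic_linear_bound kap (f v w : R -> C) (x y : R) :
  periodic f ->
  (forall t, HasDerivC f t (- Ci * kap * f t + v t - w t * f t)%C) ->
  (forall t, Cmod (v t) <= x) -> (forall t, Cmod (w t) <= y) ->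
  exists t0, (forall t, Cmod (f t) <= Cmod (f t0)) /\
    Rabs (Im kap) * Cmod (f t0) <= x + y * Cmod (f t0).
Proof.
  intros Hp Hf Hv Hw.
  destruct (periodic_max (fun t => sqmod (f t))) as [t0 Ht0].
  { intros t; now rewrite Hp. }
  { exact (continuity_of_derivative _ _ (fun t => sqmod_derivative _ _ _ (Hf t))). }
  exists t0; split.
  { intros t; specialize (Ht0 t); cbv beta in Ht0; rewrite !sqmod_Cmod in Ht0.
    pose proof (Cmod_ge_0 (f t)); pose proof (Cmod_ge_0 (f t0)); nra. }
  pose proof (derivative_at_max _ _ _ Ht0 (sqmod_derivative _ _ _ (Hf t0))) as Hz.
  specialize (Hv t0); specialize (Hw t0).
  pose proof (Cmod_ge_0 (f t0)) as Hd.
  assert (E : Im kap * (Cmod (f t0) * Cmod (f t0)) =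
              Re (w t0) * (Cmod (f t0) * Cmod (f t0)) - Re (Cconj (f t0) * v t0)%C).
  { rewrite <- sqmod_Cmod; unfold sqmod, Re, Im in *; simpl in *; lra. }
  pose proof (re_le_Cmod (w t0)) as Rw.
  pose proof (re_le_Cmod (Cconj (f t0) * v t0)%C) as Rv.
  rewrite Cmod_mult, Cmod_conj in Rv.
  pose proof (Cmod_ge_0 (v t0)) as Hv0.
  set (d := Cmod (f t0)) in *.
  destruct (Req_dec d 0) as [H0|H0]; [rewrite H0; lra|].
  apply (Rmult_le_reg_r d); [lra|].
  replace (Rabs (Im kap) * d * d) with (Rabs (Im kap * (d * d))).
  2:{ rewrite Rabs_mult, (Rabs_pos_eq (d * d)); nra. }
  rewrite E; unfold Rminus; eapply Rle_trans; [apply Rabs_triang|].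
  rewrite Rabs_Ropp, Rabs_mult, (Rabs_pos_eq (d * d)) by nra.
  assert (Rabs (Re (w t0)) * (d * d) <= y * (d * d)) by (apply Rmult_le_compat_r; nra).
  assert (d * Cmod (v t0) <= d * x) by (apply Rmult_le_compat_l; lra).
  nra.
Qed.

(** One [G] comes from [conj h] and one from [h q], where [|q| <= 1]. A large [|Im kap|] thus forces
    [q] towards the centre of the disc, which keeps [1 - |q|] away from zero. *)
Lemma riccati_small kap h q G t :
  riccati kap h q -> periodic q -> (forall t, Cmod (q t) <= 1) ->
  (forall t, Cmod (h t) <= G) -> Rabs (Im kap) * Cmod (q t) <= 2 * G.
Proof.
  intros Hr Hp Hq HG.
  assert (HG0 : 0 <= G) by (eapply Rle_trans; [apply Cmod_ge_0 | apply (HG t)]).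
  destruct (periodic_linear_bound kap q (fun t => Cconj (h t)) (fun t => h t * q t)%C G G)
    as [t0 [Hm Hb]]; auto.
  - intros s; rewrite Cmod_conj; apply HG.
  - intros s; rewrite Cmod_mult.
    pose proof (Cmod_ge_0 (h s)); specialize (HG s); specialize (Hq s); nra.
  - specialize (Hq t0); specialize (Hm t); pose proof (Rabs_pos (Im kap)); nra.
Qed.

(** The quadratic terms combine to [h (q + q') (q - q')], so the difference solves a linear equation
    forced by [- i (kap - kap') q']. This is the half of the contraction that leads from [mu] to
    [q]; [d] is the maximum of [|q - q'|]. *)
Lemma riccati_difference kap kap' h q q' G :
  riccati kap h q -> riccati kap' h q' -> periodic q -> periodic q' ->
  (forall t, Cmod (q t) <= 1) -> (forall t, Cmod (q' t) <= 1) ->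
  (forall t, Cmod (h t) <= G) ->
  exists d, 0 <= d /\ (forall t, Cmod (q t - q' t)%C <= d) /\
    Rabs (Im kap) * d <= Cmod (kap - kap')%C + 2 * G * d.
Proof.
  intros Hr Hr' Hp Hp' Hq Hq' HG.
  destruct (periodic_linear_bound kap (fun t => q t - q' t)%C
    (fun t => - Ci * (kap - kap') * q' t)%C (fun t => h t * (q t + q' t))%C
    (Cmod (kap - kap')%C) (2 * G)) as [t0 [Hm Hb]].
  - intros t; now rewrite Hp, Hp'.
  - intros t.
    eapply HasDerivC_eq; [| |
      exact (HasDerivC_plus _ _ _ _ _ (Hr t) (HasDerivC_scale (- RtoC 1)%C _ _ _ (Hr' t)))];
      [intros y|]; simpl; ring.
  - intros t; rewrite !Cmod_mult, Cmod_opp, Cmod_Ci.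
    specialize (Hq' t); pose proof (Cmod_ge_0 (kap - kap')%C); nra.
  - intros t; rewrite Cmod_mult, Rmult_comm.
    pose proof (Cmod_triangle (q t) (q' t)); specialize (Hq t); specialize (Hq' t).
    apply Rmult_le_compat; auto using Cmod_ge_0; lra.
  - exists (Cmod (q t0 - q' t0)%C); repeat split; auto using Cmod_ge_0.
Qed.

Lemma Cmod_le_components (z : C) (x y : R) :
  Rabs (Re z) <= x -> Rabs (Im z) <= y -> Cmod z <= x + y.
Proof.
  intros Hx Hy.
  replace z with (RtoC (Re z) + Ci * RtoC (Im z))%C.
  2:{ apply injective_projections; unfold Re, Im; simpl; ring. }
  eapply Rle_trans; [apply Cmod_triangle|].
  rewrite Cmod_mult, Cmod_Ci, !Cmod_R; lra.
Qed.

(* For [Im kap] large, the location of [mu] in terms of [q] and the dependence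
   of [q] on [mu] compose to a strict contraction. *)
Lemma profile_unique_large nu h (th : C) mu mu' phi phi' q q' f f' j G kap kap' :
  continuousC h -> periodic h -> (forall t, Cmod (h t) <= G) ->
  profile nu h mu phi q -> profile nu h mu' phi' q' ->
  riccati kap h q -> riccati kap' h q' ->
  (kap - kap' = th * (mu - mu'))%C ->
  Winding f j -> (forall t, 0 < Re (f t * Cconj (phi t))%C) ->
  Winding f' j -> (forall t, 0 < Re (f' t * Cconj (phi' t))%C) ->
  2 * G * Cmod th + 2 * G < Rabs (Im kap) ->
  mu = mu' /\ forall t, q t = q' t.
Proof.
  intros Hh Hhp HG Hp Hp' Hr Hr' Hth Hw Hpos Hw' Hpos' Hlarge.
  assert (HG0 : 0 <= G) by (eapply Rle_trans; [apply Cmod_ge_0 | apply (HG 0)]).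
  destruct (riccati_difference kap kap' h q q' G) as [d [Hd0 [Hd Hb]]];
    auto; try (eapply ratio_periodic; eassumption); try (eapply ratio_le_1; eassumption).
  destruct (mu_comparison _ _ _ _ _ _ _ _ _ _ _ _ _ _ Hh Hhp HG Hp Hp' Hw Hpos Hw' Hpos' Hd)
    as [HIm HRe].
  replace (Re (mu - mu')%C - (IZR j - IZR j)) with (Re (mu - mu')%C) in HRe by ring.
  pose proof (Cmod_le_components _ _ _ HRe HIm) as Hmu.
  rewrite Hth, Cmod_mult in Hb.
  pose proof (Cmod_ge_0 th) as Hth0.
  (* Chaining the bounds gives [|Im kap| d <= (2 G |th| + 2 G) d]. The first [2 G] adds the errors
     of the real and imaginary parts of [mu - mu']; the second bounds [h (q + q')]. *)
  assert (d = 0).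
  { assert (Cmod th * Cmod (mu - mu')%C <= Cmod th * (2 * G * d)) by (apply Rmult_le_compat_l; lra).
    destruct (Req_dec d 0) as [|Hd1]; [assumption|exfalso].
    assert (0 < d) by lra.
    assert (0 < (Rabs (Im kap) - (2 * G * Cmod th + 2 * G)) * d) by (apply Rmult_lt_0_compat; lra).
    nra. }
  subst d.
  split; [apply Cmod_minus_le_0; lra | intros t; apply Cmod_minus_le_0, Hd].
Qed.

(** * Separation of variables: from basic solutions to ordinary differential equations *)

Lemma HasDerivC_eq_pos (f g : R -> C) (x : R) (l : C) :
  0 < x -> (forall y, 0 < y -> f y = g y) -> HasDerivC f x l -> HasDerivC g x l.
Proof.
  intros Hx Hfg [H1 H2].
  assert (Hloc : locally x (fun y => f y = g y)).
  { exists (mkposreal x Hx); intros y Hy; apply Hfg.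
    unfold ball in Hy; simpl in Hy; unfold AbsRing_ball, abs, minus, plus, opp in Hy.
    simpl in Hy; apply Rabs_def2 in Hy; lra. }
  split; apply is_derive_Reals.
  - apply (is_derive_ext_loc (fun y => fst (f y))); [|now apply is_derive_Reals].
    revert Hloc; apply filter_imp; intros y ->; reflexivity.
  - apply (is_derive_ext_loc (fun y => snd (f y))); [|now apply is_derive_Reals].
    revert Hloc; apply filter_imp; intros y ->; reflexivity.
Qed.

Lemma Cmod_Cpow (r : R) (s : C) : Cmod (Defs.Cpow r s) = Rpower r (fst s).
Proof. exact (Cmod_cis_exp (fst s * ln r) (snd s * ln r)). Qed.

Lemma Cpow_1_l (s : C) : Defs.Cpow 1 s = RtoC 1.
Proof.
  unfold Defs.Cpow, Rpower; rewrite ln_1, !Rmult_0_r, exp_0, cos_0, sin_0.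
  apply injective_projections; simpl; ring.
Qed.

Lemma Cpow_derivative (s : C) (r : R) :
  0 < r -> HasDerivC (fun y => Defs.Cpow y s) r (RtoC (/ r) * (s * Defs.Cpow r s))%C.
Proof.
  intros Hr.
  pose proof (derivable_pt_lim_ln r Hr) as Hln.
  eapply HasDerivC_eq; [intros y; reflexivity | |
    exact (cis_exp_derivative (fun y => fst s * ln y) (fun y => snd s * ln y) r _ _
      (derivable_pt_lim_scal _ (fst s) _ _ Hln) (derivable_pt_lim_scal _ (snd s) _ _ Hln))].
  change (cis_exp (fst s * ln r) (snd s * ln r)) with (Defs.Cpow r s).
  rewrite Cmult_assoc; f_equal.
  apply injective_projections; simpl; ring.
Qed.

(** Only the radial derivative can be read off the separated form, since a basic solution comes with
    no differentiability of [phi] and [psi]; the angular derivative [ut] stays abstract. *)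
Lemma separated_solution_pde lam nu c w (s : C) (phi psi : R -> C) :
  IsSolution lam nu c (fun r => 0 < r) w ->
  (forall r t, 0 < r ->
     w r t = (Defs.Cpow r s * phi t + Cconj (Defs.Cpow r s * psi t))%C) ->
  exists ut : R -> R -> C, forall r t, 0 < r ->
    HasDerivC (w r) t (ut r t) /\
    (lam * ut r t - Ci * (s * Defs.Cpow r s * phi t + Cconj (s * Defs.Cpow r s * psi t))
     + Ci * nu * lam * w r t - c t * Cconj (w r t) = 0)%C.
Proof.
  intros [_ [_ [ur [ut Hsol]]]] Hw; exists ut; intros r t Hr.
  destruct (Hsol r t Hr) as [Hur [Hut HL]]; split; [exact Hut|].
  set (P := Defs.Cpow r s) in *.
  assert (Er : ur r t = (RtoC (/ r) * (s * P * phi t + Cconj (s * P * psi t)))%C).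
  { eapply HasDerivC_unique; [exact Hur|].
    apply (HasDerivC_eq_pos
      (fun y => Defs.Cpow y s * phi t + Cconj (Defs.Cpow y s * psi t))%C); [exact Hr| |].
    { intros y Hy; now rewrite Hw. }
    pose proof (HasDerivC_mult _ _ _ _ _ (Cpow_derivative s r Hr)
                  (HasDerivC_const (phi t) r)) as D1.
    pose proof (HasDerivC_conj _ _ _ (HasDerivC_mult _ _ _ _ _ (Cpow_derivative s r Hr)
                  (HasDerivC_const (psi t) r))) as D2.
    eapply HasDerivC_eq; [intros y; reflexivity | | exact (HasDerivC_plus _ _ _ _ _ D1 D2)].
    fold P; rewrite !Cplus_conj, !Cmult_conj.
    replace (Cconj (RtoC (/ r))) with (RtoC (/ r)).
    2:{ apply injective_projections; simpl; ring. }
    replace (Cconj (RtoC 0)) with (RtoC 0).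
    2:{ apply injective_projections; simpl; ring. }
    ring. }
  assert (Es : Cscal r (ur r t) = (s * P * phi t + Cconj (s * P * psi t))%C).
  { rewrite Er; set (z := (s * P * phi t + Cconj (s * P * psi t))%C).
    apply injective_projections; unfold Cscal; simpl; field; lra. }
  unfold Lop in HL; rewrite Es in HL.
  refine (eq_trans _ HL); set (z := (s * P * phi t + Cconj (s * P * psi t))%C).
  apply injective_projections; simpl; ring.
Qed.

(** Differentiability of [phi] and [psi] is recovered from [w] at two radii: [w 1] and [w r1] are
    combinations of [phi] and [conj psi] with an invertible constant matrix. The same elimination
    splits the equation of [w] into one equation for each. *)
Lemma basic_system a b nu c w s :
  0 < a -> IsBasic (a, b) nu c w s -> snd s <> 0 ->
  exists phi psi : R -> C,
    periodic phi /\ periodic psi /\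
    (forall r t, 0 < r ->
       w r t = (Defs.Cpow r s * phi t + Cconj (Defs.Cpow r s * psi t))%C) /\
    (forall t, Cmod (psi t) < Cmod (phi t)) /\
    (forall t, HasDerivC phi t
       (Ci * (s / (a, b) - nu) * phi t + c t / (a, b) * psi t)%C) /\
    (forall t, HasDerivC psi t
       (- Ci * (s / Cconj (a, b) - nu) * psi t + Cconj (c t / (a, b)) * phi t)%C).
Proof.
  intros Ha [Hsol [_ (phi & psi & Hphi & Hpsi & Hw & Hdom & _)]] Hs.
  change (forall r t, 0 < r -> w r t =
    (Defs.Cpow r s * phi t + Cconj (Defs.Cpow r s * psi t))%C) in Hw.
  exists phi, psi; split; [exact Hphi|]; split; [exact Hpsi|]; split; [exact Hw|].
  split; [intros t; rewrite <- !Cnorm_Cmod; now apply Hdom|].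
  destruct (separated_solution_pde _ _ _ _ _ _ _ Hsol Hw) as [ut Hut].
  set (lam := (a, b) : C) in *.
  assert (Hlam : lam <> RtoC 0) by (intros E; apply (f_equal fst) in E; simpl in E; lra).
  assert (Hlamc : Cconj lam <> RtoC 0) by (intros E; apply (f_equal fst) in E; simpl in E; lra).
  (* This radius gives [p = r1^s] the argument [PI / 2], so that the determinant [p - conj p] is
     nonzero; it exists because [Im s <> 0]. *)
  set (r1 := exp (PI / (2 * snd s))).
  assert (Hr1 : 0 < r1) by apply exp_pos.
  set (p := Defs.Cpow r1 s).
  assert (Hp : (p - Cconj p)%C <> RtoC 0).
  { intros E; apply (f_equal snd) in E; unfold p, Defs.Cpow, r1 in E; simpl in E.
    rewrite ln_exp in E.
    replace (snd s * (PI / (2 * snd s))) with (PI / 2) in E by (field; auto).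
    rewrite sin_PI2 in E; unfold Rpower in E.
    pose proof (exp_pos (fst s * ln (exp (PI / (2 * snd s))))); lra. }
  set (dphi := fun t => ((ut r1 t - Cconj p * ut 1 t) / (p - Cconj p))%C).
  set (dchi := fun t => ((p * ut 1 t - ut r1 t) / (p - Cconj p))%C).
  assert (W1 : forall t, w 1 t = (phi t + Cconj (psi t))%C).
  { intros t; rewrite Hw by lra; rewrite Cpow_1_l, !Cmult_1_l; reflexivity. }
  assert (W2 : forall t, w r1 t = (p * phi t + Cconj p * Cconj (psi t))%C).
  { intros t; rewrite Hw by exact Hr1; now rewrite Cmult_conj. }
  assert (Dphi : forall t, HasDerivC phi t (dphi t)).
  { intros t; destruct (Hut r1 t Hr1) as [D2 _]; destruct (Hut 1 t Rlt_0_1) as [D1 _].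
    eapply HasDerivC_eq; [| | exact (HasDerivC_plus _ _ _ _ _
      (HasDerivC_scale (/ (p - Cconj p))%C _ _ _ D2)
      (HasDerivC_scale (- Cconj p / (p - Cconj p))%C _ _ _ D1))].
    - intros y; simpl; rewrite W1, W2; field; exact Hp.
    - unfold dphi; field; exact Hp. }
  assert (Dchi : forall t, HasDerivC (fun y => Cconj (psi y)) t (dchi t)).
  { intros t; destruct (Hut r1 t Hr1) as [D2 _]; destruct (Hut 1 t Rlt_0_1) as [D1 _].
    eapply HasDerivC_eq; [| | exact (HasDerivC_plus _ _ _ _ _
      (HasDerivC_scale (- / (p - Cconj p))%C _ _ _ D2)
      (HasDerivC_scale (p / (p - Cconj p))%C _ _ _ D1))].
    - intros y; simpl; rewrite W1, W2; field; exact Hp.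
    - unfold dchi; field; exact Hp. }
  assert (HE : forall t,
     (lam * dphi t - Ci * s * phi t + Ci * nu * lam * phi t - c t * psi t = 0)%C /\
     (lam * dchi t - Ci * Cconj s * Cconj (psi t) + Ci * nu * lam * Cconj (psi t)
      - c t * Cconj (phi t) = 0)%C).
  { intros t; destruct (Hut r1 t Hr1) as [_ L2]; destruct (Hut 1 t Rlt_0_1) as [_ L1].
    rewrite W1, Cpow_1_l in L1; rewrite W2 in L2; fold p in L2.
    rewrite !Cmult_1_r, Cplus_conj, Cconj_conj, !Cmult_conj in L1.
    rewrite Cplus_conj, !Cmult_conj, !Cconj_conj in L2.
    assert (U1 : ut 1 t = (dphi t + dchi t)%C) by (unfold dphi, dchi; field; exact Hp).
    assert (U2 : ut r1 t = (p * dphi t + Cconj p * dchi t)%C)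
      by (unfold dphi, dchi; field; exact Hp).
    rewrite U1 in L1; rewrite U2 in L2; clear U1 U2.
    set (E1 := (lam * dphi t - Ci * s * phi t + Ci * nu * lam * phi t - c t * psi t)%C).
    set (E2 := (lam * dchi t - Ci * Cconj s * Cconj (psi t) + Ci * nu * lam * Cconj (psi t)
      - c t * Cconj (phi t))%C).
    assert (S1 : (E1 + E2 = 0)%C) by (rewrite <- L1; unfold E1, E2; ring).
    assert (S2 : (p * E1 + Cconj p * E2 = 0)%C) by (rewrite <- L2; unfold E1, E2; ring).
    split.
    - replace E1 with ((p * E1 + Cconj p * E2 - Cconj p * (E1 + E2)) / (p - Cconj p))%C
        by (field; exact Hp).
      rewrite S1, S2; field; exact Hp.
    - replace E2 with ((p * (E1 + E2) - (p * E1 + Cconj p * E2)) / (p - Cconj p))%C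
        by (field; exact Hp).
      rewrite S1, S2; field; exact Hp. }
  split.
  - intros t; eapply HasDerivC_eq; [intros y; reflexivity | | exact (Dphi t)].
    destruct (HE t) as [E1 _]; cbv beta.
    transitivity ((lam * dphi t - Ci * s * phi t + Ci * nu * lam * phi t - c t * psi t) / lam
      + (Ci * (s / lam - nu) * phi t + c t / lam * psi t))%C; [field; exact Hlam|].
    rewrite E1; field; exact Hlam.
  - intros t; eapply HasDerivC_eq; [| | exact (HasDerivC_conj _ _ _ (Dchi t))].
    { intros y; simpl; apply Cconj_conj. }
    destruct (HE t) as [_ E2].
    assert (E3 : dchi t = (Ci * (Cconj s / lam - nu) * Cconj (psi t)
                          + c t / lam * Cconj (phi t))%C).
    { transitivity ((lam * dchi t - Ci * Cconj s * Cconj (psi t) + Ci * nu * lam * Cconj (psi t)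
        - c t * Cconj (phi t)) / lam
        + (Ci * (Cconj s / lam - nu) * Cconj (psi t) + c t / lam * Cconj (phi t)))%C;
        [field; exact Hlam|].
      rewrite E2; field; exact Hlam. }
    rewrite E3, Cplus_conj, !Cmult_conj, !Cconj_conj, Cminus_conj, Cdiv_conj, Cconj_conj by exact Hlam.
    replace (Cconj Ci) with (- Ci)%C by (apply injective_projections; simpl; ring).
    replace (Cconj (RtoC nu)) with (RtoC nu) by (apply injective_projections; simpl; ring).
    reflexivity.
Qed.

(** The quotient rule for [psi / phi] adds [s / lam - nu] and [s / conj lam - nu]. As
    [1 / lam + 1 / conj lam = 2 a / |lam|^2] is real and positive, [Im kap] is a positive multiple
    of [Im s]. The last clause links [phi] to the winding number of [w]. *)
Lemma nonreal_mode a b nu c w s :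
  0 < a -> IsBasic (a, b) nu c w s -> snd s <> 0 ->
  exists phi q : R -> C,
    profile nu (fun t => c t / (a, b))%C (s / (a, b))%C phi q /\
    riccati (2 * a / (a * a + b * b) * s - 2 * nu)%C (fun t => c t / (a, b))%C q /\
    (forall t, Cmod (q t) < 1) /\
    (forall r t, 0 < r ->
       w r t = (Defs.Cpow r s * phi t + Cconj (Defs.Cpow r s * (q t * phi t)))%C) /\
    (forall t, 0 < Re (w 1 t * Cconj (phi t))%C).
Proof.
  intros Ha HB Hs.
  destruct (basic_system a b nu c w s Ha HB Hs)
    as (phi & psi & Pphi & Ppsi & Hw & Hdom & Dphi & Dpsi).
  set (h := fun t => (c t / (a, b))%C) in *.
  assert (Hnz : forall t, phi t <> RtoC 0).
  { intros t; apply Cmod_gt_0; specialize (Hdom t); pose proof (Cmod_ge_0 (psi t)); lra. }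
  exists phi, (fun t => psi t / phi t)%C.
  assert (Hq : forall t, Cmod (psi t / phi t)%C < 1).
  { intros t; rewrite Cmod_div by apply Hnz.
    pose proof (proj1 (Cmod_gt_0 _) (Hnz t)) as Hp.
    apply (Rmult_lt_reg_r (Cmod (phi t))); [exact Hp|].
    unfold Rdiv; rewrite Rmult_assoc, Rinv_l; [specialize (Hdom t)|]; lra. }
  assert (Hr : riccati (2 * a / (a * a + b * b) * s - 2 * nu)%C h (fun t => psi t / phi t)%C).
  { intros t; eapply HasDerivC_eq; [intros y; reflexivity | |
      exact (HasDerivC_div _ _ _ _ _ (Hnz t) (Dpsi t) (Dphi t))].
    fold (h t); cbv beta.
    assert (Hk : (2 * a / (a * a + b * b) * s = s / (a, b) + s / Cconj (a, b))%C).
    { assert (a * a + b * b <> 0) by nra.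
      apply injective_projections; unfold Cdiv, Cinv, Cmult, Cplus, Cconj, RtoC; simpl;
        field; repeat split; nra. }
    rewrite Hk; generalize (s / (a, b))%C (s / Cconj (a, b))%C; intros u v.
    field; apply Hnz. }
  split; [split|split; [exact Hr|split; [exact Hq|split]]].
  - exact Pphi.
  - exact Hnz.
  - intros t; eapply HasDerivC_eq; [intros y; reflexivity | | exact (Dphi t)].
    fold (h t); cbv beta; field; split; [apply Hnz|].
    intros E; apply (f_equal fst) in E; simpl in E; lra.
  - intros t; now rewrite Pphi, Ppsi.
  - exact (HasDerivC_continuous _ _ Hr).
  - intros t; left; apply Hq.
  - intros r t Hr0; rewrite Hw by exact Hr0; do 3 f_equal; field; apply Hnz.
  - intros t; rewrite Hw by lra; rewrite Cpow_1_l, !Cmult_1_l.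
    rewrite Cmult_plus_distr_r, re_plus.
    pose proof (re_le_Cmod (Cconj (psi t) * Cconj (phi t))%C) as H1.
    rewrite Cmod_mult, !Cmod_conj in H1; apply Rabs_le_between in H1.
    replace (Re (phi t * Cconj (phi t))%C) with (sqmod (phi t))
      by (unfold Re, sqmod; simpl; ring).
    rewrite sqmod_Cmod; specialize (Hdom t); pose proof (Cmod_ge_0 (psi t)); nra.
Qed.

Lemma real_mode a b nu c w s j :
  0 < a -> IsBasic (a, b) nu c w s -> Winding (fun t => w 1 t) j -> snd s = 0 ->
  exists f : R -> C,
    periodic f /\ (forall t, f t <> RtoC 0) /\ Winding f j /\
    (forall t, HasDerivC f t
       (Ci * (s / (a, b) - nu) * f t + c t / (a, b) * Cconj (f t))%C) /\
    (forall r t, 0 < r -> w r t = (Defs.Cpow r s * f t)%C).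
Proof.
  intros Ha [Hsol [_ (phi & psi & Hphi & Hpsi & Hw & _ & Hreal)]] Hwind Hs.
  change (forall r t, 0 < r -> w r t =
    (Defs.Cpow r s * phi t + Cconj (Defs.Cpow r s * psi t))%C) in Hw.
  destruct (separated_solution_pde _ _ _ _ _ _ _ Hsol Hw) as [ut Hut].
  assert (Hw' : forall r t, 0 < r -> w r t = (Defs.Cpow r s * phi t)%C).
  { intros r t Hr; rewrite Hw, (Hreal Hs t) by exact Hr.
    apply injective_projections; simpl; ring. }
  assert (W1 : forall t, w 1 t = phi t).
  { intros t; rewrite Hw' by lra; rewrite Cpow_1_l; apply Cmult_1_l. }
  assert (Hlam : ((a, b) : C) <> RtoC 0)
    by (intros E; apply (f_equal fst) in E; simpl in E; lra).
  assert (Hwphi : Winding phi j).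
  { destruct Hwind as [H0 [th [H1 [H2 H3]]]]; split.
    - intros t; rewrite <- W1; apply H0.
    - exists th; split; [exact H1|]; split; [|exact H3].
      intros t; rewrite <- W1; apply H2. }
  exists phi; split; [exact Hphi|]; split; [apply Hwphi|].
  split; [exact Hwphi|]; split; [|exact Hw'].
  intros t; destruct (Hut 1 t Rlt_0_1) as [D L].
  eapply HasDerivC_eq; [exact W1 | | exact D].
  rewrite W1, (Hreal Hs t), Cpow_1_l in L.
  replace (Cconj (s * RtoC 1 * C0))%C with (RtoC 0) in L.
  2:{ apply injective_projections; simpl; ring. }
  transitivity ((((a, b) : C) * ut 1%R t - Ci * (s * RtoC 1 * phi t + RtoC 0)
    + Ci * nu * (a, b) * phi t - c t * Cconj (phi t)) / (a, b)
    + (Ci * (s / (a, b) - nu) * phi t + c t / (a, b) * Cconj (phi t)))%C;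
    [field; exact Hlam|].
  rewrite L; field; exact Hlam.
Qed.

(** * Real exponents: uniqueness and winding for a real-linear equation *)

(** Conjugation makes the equation only real linear, so quotients of solutions need not be constant.
    Gronwall's argument is applied to [N = |f|^2] instead: since [|N'| <= K N], the function
    [N exp(- K t)] does not increase and [N exp(K t)] does not decrease, which covers both sides of
    [t0]. *)
Lemma real_linear_unique (z : C) (h f : R -> C) (G t0 : R) :
  (forall t, Cmod (h t) <= G) ->
  (forall t, HasDerivC f t (z * f t + h t * Cconj (f t))%C) ->
  f t0 = RtoC 0 -> forall t, f t = RtoC 0.
Proof.
  intros HG Hf H0.
  set (K := 2 * (Cmod z + G)).
  set (N := fun t => sqmod (f t)).
  set (n := fun t => 2 * Re (Cconj (f t) * (z * f t + h t * Cconj (f t)))%C).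
  assert (HN : forall t, derivable_pt_lim N t (n t))
    by (intros t; apply sqmod_derivative, Hf).
  assert (HnK : forall t, Rabs (n t) <= K * N t).
  { intros t; unfold n, K, N; rewrite Rabs_mult, (Rabs_pos_eq 2) by lra.
    rewrite Rmult_assoc; apply Rmult_le_compat_l; [lra|].
    eapply Rle_trans; [apply re_le_Cmod|].
    rewrite Cmod_mult, Cmod_conj, sqmod_Cmod.
    pose proof (Cmod_triangle (z * f t) (h t * Cconj (f t)))%C as Ht.
    rewrite !Cmod_mult, Cmod_conj in Ht.
    pose proof (Cmod_ge_0 (f t)); specialize (HG t).
    assert (Cmod (h t) * Cmod (f t) <= G * Cmod (f t)) by (apply Rmult_le_compat_r; lra).
    replace ((Cmod z + G) * (Cmod (f t) * Cmod (f t)))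
      with (Cmod (f t) * (Cmod z * Cmod (f t) + G * Cmod (f t))) by ring.
    apply Rmult_le_compat_l; lra. }
  assert (HE : forall k t, derivable_pt_lim (fun t => N t * exp (k * t)) t
                           ((n t + k * N t) * exp (k * t))).
  { intros k t.
    assert (He : derivable_pt_lim (fun t => exp (k * t)) t (k * exp (k * t)))
      by (apply is_derive_Reals; auto_derive; auto; ring).
    eapply derivable_pt_lim_eq; [intros y; reflexivity | |
      exact (derivable_pt_lim_mult _ _ _ _ _ (HN t) He)].
    simpl; ring. }
  assert (HN0 : N t0 = 0) by (unfold N; rewrite H0; unfold sqmod; simpl; ring).
  assert (Hle : forall t, N t <= 0).
  { intros t; destruct (Rle_dec t0 t) as [Ht|Ht].
    - destruct (mvt_whole _ _ t0 t (HE (- K))) as [x Hx]; cbv beta in Hx.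
      rewrite HN0 in Hx; specialize (HnK x); apply Rabs_le_between in HnK.
      pose proof (exp_pos (- K * x)); pose proof (exp_pos (- K * t)).
      assert ((n x + - K * N x) * exp (- K * x) <= 0) by nra.
      assert (N t * exp (- K * t) <= 0) by nra.
      nra.
    - destruct (mvt_whole _ _ t0 t (HE K)) as [x Hx]; cbv beta in Hx.
      rewrite HN0 in Hx; specialize (HnK x); apply Rabs_le_between in HnK.
      pose proof (exp_pos (K * x)); pose proof (exp_pos (K * t)).
      assert (0 <= (n x + K * N x) * exp (K * x)) by nra.
      assert (N t * exp (K * t) <= 0) by nra.
      nra. }
  intros t; apply Cmod_eq_0; specialize (Hle t); unfold N in Hle.
  rewrite sqmod_Cmod in Hle; pose proof (Cmod_ge_0 (f t)); nra.
Qed.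

Lemma real_linear_combination (z : C) (h f g : R -> C) (x y : R) :
  (forall t, HasDerivC f t (z * f t + h t * Cconj (f t))%C) ->
  (forall t, HasDerivC g t (z * g t + h t * Cconj (g t))%C) ->
  forall t, HasDerivC (fun t => x * f t + y * g t)%C t
    (z * (x * f t + y * g t) + h t * Cconj (x * f t + y * g t))%C.
Proof.
  intros Hf Hg t.
  eapply HasDerivC_eq; [intros s; reflexivity | |
    exact (HasDerivC_plus _ _ _ _ _ (HasDerivC_scale x _ _ _ (Hf t))
             (HasDerivC_scale y _ _ _ (Hg t)))].
  rewrite Cplus_conj, !Cmult_conj.
  replace (Cconj (RtoC x)) with (RtoC x) by (apply injective_projections; simpl; ring).
  replace (Cconj (RtoC y)) with (RtoC y) by (apply injective_projections; simpl; ring).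
  ring.
Qed.

(* If the winding numbers differed, the two curves would be real-proportional
   at some [t], hence for all [t], and their arguments could not drift apart. *)
Lemma real_mode_same_winding (z : C) (h f g : R -> C) (G : R) (j k : Z) :
  (forall t, Cmod (h t) <= G) ->
  (forall t, HasDerivC f t (z * f t + h t * Cconj (f t))%C) ->
  (forall t, HasDerivC g t (z * g t + h t * Cconj (g t))%C) ->
  Winding f j -> Winding g k -> j = k.
Proof.
  intros HG Hf Hg [Hf0 [th [Hth [Ef Hj]]]] [Hg0 [et [Het [Eg Hk]]]].
  destruct (Z.eq_dec j k) as [?|Hjk]; [assumption|exfalso].
  pose proof PI_RGT_0 as Hpi.
  set (D := fun t => th t - et t).
  assert (HDc : continuity D) by now apply (continuity_minus th et).
  assert (HDq : forall t, D (t + 2 * PI) = D t + 2 * PI * (IZR j - IZR k))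
    by (intros t; unfold D; rewrite Hj, Hk; ring).
  assert (He : 2 * PI * (IZR j - IZR k) <> 0).
  { apply Rmult_integral_contrapositive; split; [lra|].
    intros E; apply Hjk, eq_IZR; lra. }
  assert (HIm : forall t, Im (f t * Cconj (g t))%C = Cmod (f t) * Cmod (g t) * sin (D t)).
  { intros t; rewrite (Ef t) at 1; rewrite (Eg t) at 1; rewrite !Cnorm_Cmod.
    unfold D; rewrite sin_minus; unfold Im, Cscal; simpl; ring. }
  destruct (quasiperiodic_reaches D _ HDc HDq He PI) as [t1 Ht1]; [lra|].
  assert (Hs1 : sin (D t1) = - sin (D 0)).
  { unfold Rabs in Ht1; destruct (Rcase_abs (D t1 - D 0)).
    - replace (D 0) with (D t1 + PI) by lra; rewrite neg_sin; lra.
    - replace (D t1) with (D 0 + PI) by lra; rewrite neg_sin; lra. }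
  (* The sine of the angle difference takes opposite values at [0] and [t1], so it vanishes at some
     [t2]: there [f] and [g] are real-proportional. *)
  destruct (IVT_gen (fun t => sin (D t)) 0 t1 0) as [t2 [_ Ht2]].
  { exact (continuity_comp D sin HDc continuity_sin). }
  { rewrite Hs1; unfold Rmin, Rmax; destruct (Rle_dec _ _); lra. }
  (* By the identity [|g|^2 f - Re (f conj g) g = i Im (f conj g) g], these real coefficients give a
     combination vanishing at [t2]. *)
  set (x := sqmod (g t2)); set (y := - Re (f t2 * Cconj (g t2))%C).
  assert (Hx : 0 < x).
  { unfold x; rewrite sqmod_Cmod.
    pose proof (proj1 (Cmod_gt_0 (g t2)) (Hg0 t2)); nra. }
  assert (Hzero : forall t, (x * f t + y * g t = 0)%C).
  { apply (real_linear_unique z h (fun t => x * f t + y * g t)%C G t2 HG).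
    - now apply real_linear_combination.
    - pose proof (HIm t2) as E; rewrite Ht2, Rmult_0_r in E.
      replace (x * f t2 + y * g t2)%C with (RtoC (Im (f t2 * Cconj (g t2))%C) * (Ci * g t2))%C.
      + rewrite E; ring.
      + unfold x, y, sqmod, Re, Im; apply injective_projections; simpl; ring. }
  assert (Hsin : forall t, sin (D t) = 0).
  { intros t; specialize (Hzero t).
    assert (E : x * Im (f t * Cconj (g t))%C = 0).
    { transitivity (Im ((x * f t + y * g t) * Cconj (g t))%C).
      - unfold Im; simpl; ring.
      - rewrite Hzero; unfold Im; simpl; ring. }
    rewrite HIm in E.
    pose proof (proj1 (Cmod_gt_0 (f t)) (Hf0 t)); pose proof (proj1 (Cmod_gt_0 (g t)) (Hg0 t)).
    assert (0 < x * (Cmod (f t) * Cmod (g t))) by (repeat apply Rmult_lt_0_compat; auto).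
    apply (Rmult_eq_reg_l (x * (Cmod (f t) * Cmod (g t)))); lra. }
  (* The sine of [D] now vanishes identically. A shift of the angle by [PI / 2] turns sine into
     cosine, so both would vanish at [D 0]. *)
  destruct (quasiperiodic_reaches D _ HDc HDq He (PI / 2)) as [t3 Ht3]; [lra|].
  pose proof (Hsin 0) as S0; pose proof (Hsin t3) as S3.
  pose proof (sin2_cos2 (D 0)) as SC; unfold Rsqr in SC; rewrite S0 in SC.
  assert (C0' : cos (D 0) = 0).
  { unfold Rabs in Ht3; destruct (Rcase_abs (D t3 - D 0)).
    - replace (D t3) with (- (PI / 2 - D 0)) in S3 by lra.
      rewrite sin_neg, sin_shift in S3; lra.
    - replace (D t3) with (PI / 2 - - D 0) in S3 by lra.
      rewrite sin_shift, cos_neg in S3; lra. }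
  rewrite C0' in SC; lra.
Qed.

(** * Growth and location of a single basic solution *)

Lemma basic_profile a b nu c w s j :
  0 < a -> IsBasic (a, b) nu c w s -> Winding (fun t => w 1 t) j ->
  exists phi q : R -> C,
    profile nu (fun t => c t / (a, b))%C (s / (a, b))%C phi q /\
    (forall t, 0 < Re (w 1 t * Cconj (phi t))%C) /\
    (forall r t, 0 < r -> Cmod (w r t) <= 2 * (Rpower r (fst s) * Cmod (phi t))).
Proof.
  intros Ha HB Hw; destruct (Req_dec (snd s) 0) as [Hs|Hs].
  - destruct (real_mode a b nu c w s j Ha HB Hw Hs) as (f & Pf & Nf & Wf & Df & Ef).
    assert (Nfc : forall t, Cconj (f t) <> RtoC 0).
    { intros t; apply Cmod_gt_0; rewrite Cmod_conj; now apply Cmod_gt_0. }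
    exists f, (fun t => Cconj (f t) / f t)%C; split; [split|split].
    + exact Pf.
    + exact Nf.
    + intros t; eapply HasDerivC_eq; [intros y; reflexivity | | exact (Df t)].
      cbv beta; field; split; [apply Nf|].
      intros E; apply (f_equal fst) in E; simpl in E; lra.
    + intros t; now rewrite Pf.
    + apply (HasDerivC_continuous _ _ (fun t =>
        HasDerivC_div _ _ _ _ _ (Nf t) (HasDerivC_conj _ _ _ (Df t)) (Df t))).
    + intros t; rewrite Cmod_div, Cmod_conj by apply Nf.
      right; field; apply Rgt_not_eq, Cmod_gt_0, Nf.
    + intros t; rewrite Ef, Cpow_1_l, Cmult_1_l by lra.
      replace (Re (f t * Cconj (f t))%C) with (sqmod (f t)) by (unfold Re, sqmod; simpl; ring).
      rewrite sqmod_Cmod; pose proof (proj1 (Cmod_gt_0 _) (Nf t)); nra.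
    + intros r t Hr; rewrite Ef, Cmod_mult, Cmod_Cpow by exact Hr.
      assert (0 <= Rpower r (fst s) * Cmod (f t)); [|lra].
      apply Rmult_le_pos; [left; apply exp_pos | apply Cmod_ge_0].
  - destruct (nonreal_mode a b nu c w s Ha HB Hs) as (phi & q & Hp & _ & Hq & Ew & Hpos).
    exists phi, q; split; [exact Hp|split; [exact Hpos|]].
    intros r t Hr; rewrite Ew by exact Hr.
    eapply Rle_trans; [apply Cmod_triangle|].
    rewrite Cmod_conj, !Cmod_mult, Cmod_Cpow.
    assert (0 <= Rpower r (fst s) * Cmod (phi t)).
    { apply Rmult_le_pos; [left; apply exp_pos | apply Cmod_ge_0]. }
    specialize (Hq t); pose proof (Cmod_ge_0 (q t)); nra.
Qed.

Lemma basic_growth a b nu c w s j :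
  0 < a -> IsBasic (a, b) nu c w s -> Winding (fun t => w 1 t) j ->
  exists K, 0 < K /\ forall r t, 0 < r -> Cmod (w r t) <= K * Rpower r (fst s).
Proof.
  intros Ha HB Hw.
  destruct (basic_profile _ _ _ _ _ _ _ Ha HB Hw) as (phi & q & Hp & _ & Hb).
  destruct (periodic_bounded phi) as [K [HK HKb]].
  - exact (profile_periodic _ _ _ _ _ Hp).
  - exact (HasDerivC_continuous _ _ (profile_derivative _ _ _ _ _ Hp)).
  - exists (2 * K); split; [lra|]; intros r t Hr.
    eapply Rle_trans; [now apply Hb|].
    specialize (HKb t); pose proof (exp_pos (fst s * ln r)) as He.
    fold (Rpower r (fst s)) in He; nra.
Qed.

(** This is the location of [mu = s / lam] multiplied by [lam], with [G] bounding both coordinates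
    of the error. The real part, close to [a j], decides which indices finite order removes; the
    imaginary part, close to [b j], makes exponents with large [|j|] non-real once [b <> 0]. *)
Lemma exponent_location a b nu c w (s : C) j G :
  0 < a -> IsBasic (a, b) nu c w s -> Winding (fun t => w 1 t) j ->
  continuousC (fun t => c t / (a, b))%C -> periodic (fun t => c t / (a, b))%C ->
  (forall t, Cmod (c t / (a, b))%C <= G) ->
  Rabs (Im (s / (a, b))%C) <= G /\
  Rabs (fst s - a * (nu + IZR j)) <= (a + Rabs b) * G /\
  Rabs (snd s - b * (nu + IZR j)) <= (a + Rabs b) * G.
Proof.
  intros Ha HB Hw Hc Hper HG.
  destruct (basic_profile _ _ _ _ _ _ _ Ha HB Hw) as (phi & q & Hp & Hpos & _).
  destruct (mu_location _ _ _ _ _ _ _ _ Hc Hper HG Hp Hw Hpos) as [H1 H2].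
  split; [exact H1|].
  set (mu := (s / (a, b))%C) in *.
  assert (Es : s = ((a, b) * mu)%C).
  { unfold mu; field; intros E; apply (f_equal fst) in E; simpl in E; lra. }
  assert (E1 : fst s = a * Re mu - b * Im mu) by (rewrite Es; unfold Re, Im; simpl; ring).
  assert (E2 : snd s = a * Im mu + b * Re mu) by (rewrite Es; unfold Re, Im; simpl; ring).
  rewrite E1, E2; clear E1 E2 Es.
  assert (Hab : forall x y : R, Rabs x <= G -> Rabs y <= G ->
    Rabs (a * x + b * y) <= (a + Rabs b) * G).
  { intros x y Hx Hy; eapply Rle_trans; [apply Rabs_triang|].
    rewrite !Rabs_mult, (Rabs_pos_eq a) by lra.
    pose proof (Rabs_pos b); nra. }
  split.
  - replace (_ - _) with (a * (Re mu - nu - IZR j) + b * (- Im mu)) by ring.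
    apply Hab; [exact H2 | now rewrite Rabs_Ropp].
  - replace (_ - _) with (a * Im mu + b * (Re mu - nu - IZR j)) by ring.
    now apply Hab.
Qed.

(** * Solutions sharing one exponent, with bounds uniform in the angle *)

(** The complex amplitude [z] stands for two real parameters: the conjugated term makes [mode] only
    real linear in [z], which suits the real Laurent coefficients. *)
Definition mode (s : C) (phi q : R -> C) (z : C) (r t : R) : C :=
  (Defs.Cpow r s * (z * phi t) + Cconj (Defs.Cpow r s * (q t * (z * phi t))))%C.

Lemma mode_combination s phi q z z' (x y : R) r t :
  (x * mode s phi q z r t + y * mode s phi q z' r t)%C
  = mode s phi q (x * z + y * z')%C r t.
Proof.
  unfold mode; apply injective_projections; simpl; ring.
Qed.

Lemma mode_upper s phi q z r t :
  Cmod (q t) <= 1 ->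
  Cmod (mode s phi q z r t) <= 2 * (Rpower r (fst s) * (Cmod z * Cmod (phi t))).
Proof.
  intros Hq; unfold mode; eapply Rle_trans; [apply Cmod_triangle|].
  rewrite Cmod_conj, !Cmod_mult, Cmod_Cpow.
  assert (0 <= Rpower r (fst s) * (Cmod z * Cmod (phi t))).
  { repeat apply Rmult_le_pos; try apply Cmod_ge_0; left; apply exp_pos. }
  pose proof (Cmod_ge_0 (q t)); nra.
Qed.

Lemma mode_lower s phi q z r t :
  Rpower r (fst s) * (Cmod z * (Cmod (phi t) * (1 - Cmod (q t))))
  <= Cmod (mode s phi q z r t).
Proof.
  unfold mode.
  set (x := (Defs.Cpow r s * (z * phi t))%C).
  set (y := Cconj (Defs.Cpow r s * (q t * (z * phi t)))%C).
  pose proof (Cmod_triangle (x + y) (- y)) as H.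
  replace (x + y + - y)%C with x in H by ring.
  rewrite Cmod_opp in H.
  assert (Ex : Cmod x = Rpower r (fst s) * (Cmod z * Cmod (phi t)))
    by (unfold x; now rewrite !Cmod_mult, Cmod_Cpow).
  assert (Ey : Cmod y = Rpower r (fst s) * (Cmod (q t) * (Cmod z * Cmod (phi t))))
    by (unfold y; now rewrite Cmod_conj, !Cmod_mult, Cmod_Cpow).
  rewrite Ex, Ey in H; nra.
Qed.

Lemma nonreal_mode_span a b nu c G phi q w0 j0 w j (s : C) :
  0 < a -> snd s <> 0 ->
  continuousC (fun t => c t / (a, b))%C -> periodic (fun t => c t / (a, b))%C ->
  (forall t, Cmod (c t / (a, b))%C <= G) ->
  profile nu (fun t => c t / (a, b))%C (s / (a, b))%C phi q ->
  riccati (2 * a / (a * a + b * b) * s - 2 * nu)%C (fun t => c t / (a, b))%C q ->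
  (forall t, Cmod (q t) < 1) ->
  Winding w0 j0 -> (forall t, 0 < Re (w0 t * Cconj (phi t))%C) ->
  IsBasic (a, b) nu c w s -> Winding (fun t => w 1 t) j ->
  j = j0 /\ exists z, forall r t, 0 < r -> w r t = mode s phi q z r t.
Proof.
  intros Ha Hs Hc Hper HG Hp Hr Hq Hw0 Hpos0 HB Hw.
  destruct (nonreal_mode a b nu c w s Ha HB Hs) as (phi' & q' & Hp' & Hr' & Hq' & Ew & Hpos').
  assert (Hk : Im (2 * a / (a * a + b * b) * s - 2 * nu)%C <> 0).
  { replace (Im _) with (2 * a / (a * a + b * b) * snd s).
    2:{ unfold Im; simpl; field; nra. }
    apply Rmult_integral_contrapositive; split; [|exact Hs].
    apply Rgt_not_eq, Rdiv_lt_0_compat; nra. }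
  assert (Eq : forall t, q' t = q t).
  { apply (riccati_periodic_unique _ _ _ _ Hr' Hr); auto; eapply ratio_periodic; eassumption. }
  split.
  (* With [d = 0] the comparison leaves [|j - j0| <= 0]. *)
  - assert (Hd : forall t, Cmod (q' t - q t)%C <= 0).
    { intros t; rewrite Eq.
      replace (q t - q t)%C with (RtoC 0) by ring; rewrite Cmod_0; lra. }
    destruct (mu_comparison _ _ _ _ _ _ _ _ _ _ _ _ _ _ Hc Hper HG Hp' Hp Hw Hpos' Hw0 Hpos0 Hd)
      as [_ HRe].
    replace (Re (s / (a, b) - s / (a, b))%C) with 0 in HRe.
    2:{ replace (s / (a, b) - s / (a, b))%C with (RtoC 0) by ring; reflexivity. }
    apply Rabs_le_between in HRe; apply eq_IZR; lra.
  - destruct (profile_proportional _ _ _ _ _ _ _ Hp Hp' Eq) as [z Hz].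
    exists z; intros r t Hr0; unfold mode; now rewrite Ew, Hz, Eq.
Qed.

Lemma positive_periodic_min (g : R -> R) :
  periodic g -> continuity g -> (forall t, 0 < g t) -> exists m, 0 < m /\ forall t, m <= g t.
Proof.
  intros Hp Hc Hg; destruct (periodic_min g Hp Hc) as [t0 Ht0]; exists (g t0); auto.
Qed.

(** [B] stands for the coefficients kept at one exponent [s]. Since [s] determines the winding
    number, they all sit in one pair, and independence of that pair keeps their sum from vanishing
    identically. The sum then vanishes nowhere: for real [s] by uniqueness for the real-linear
    equation, otherwise because [|q| < 1]. The minimum of a positive periodic function gives [m]. *)
Lemma leading_term a b nu c G (W : Z -> bool -> R -> R -> C) (Sg : Z -> bool -> C)
    (B : Z -> bool -> R) (s : C) (j0 : Z) (e0 : bool) :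
  0 < a ->
  continuousC (fun t => c t / (a, b))%C -> periodic (fun t => c t / (a, b))%C ->
  (forall t, Cmod (c t / (a, b))%C <= G) ->
  (forall j e, IsBasic (a, b) nu c (W j e) (Sg j e) /\ Winding (fun t => W j e 1 t) j) ->
  (forall j (al be : R),
     (forall r t, 0 < r -> (al * W j true r t + be * W j false r t = 0)%C) ->
     al = 0 /\ be = 0) ->
  (forall j e, B j e <> 0 -> Sg j e = s) -> B j0 e0 <> 0 ->
  (forall j e, B j e <> 0 -> j = j0) /\
  exists m, 0 < m /\ forall r t, 0 < r ->
    m * Rpower r (fst s) <=
    Cmod (B j0 true * W j0 true r t + B j0 false * W j0 false r t)%C.
Proof.
  intros Ha Hc Hper HG HW Hind HB H0.
  assert (Hnz : ~ (forall r t, 0 < r ->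
    (B j0 true * W j0 true r t + B j0 false * W j0 false r t = 0)%C)).
  { intros H; destruct (Hind _ _ _ H) as [H1 H2]; destruct e0; auto. }
  destruct (HW j0 e0) as [HB0 Hw0]; rewrite (HB _ _ H0) in HB0.
  destruct (Req_dec (snd s) 0) as [Hs|Hs].
  - assert (Hmode : forall j e, B j e <> 0 -> exists f : R -> C,
      periodic f /\ Winding f j /\
      (forall t, HasDerivC f t
         (Ci * (s / (a, b) - nu) * f t + c t / (a, b) * Cconj (f t))%C) /\
      (forall r t, 0 < r -> W j e r t = (Defs.Cpow r s * f t)%C)).
    { intros j e Hne; destruct (HW j e) as [HBj Hwj]; rewrite (HB _ _ Hne) in HBj.
      destruct (real_mode _ _ _ _ _ _ _ Ha HBj Hwj Hs) as (f & Pf & _ & Wf & Df & Ef).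
      now exists f. }
    destruct (Hmode j0 e0 H0) as (f0 & Pf0 & Wf0 & Df0 & Ef0).
    split.
    + intros j e Hne; destruct (Hmode j e Hne) as (f & _ & Wf & Df & _).
      exact (real_mode_same_winding _ _ _ _ _ _ _ HG Df Df0 Wf Wf0).
    (* If [B j0 e = 0], the exponent of [W j0 e] may differ from [s]; [f0] is then a placeholder
       with coefficient zero. *)
    + assert (Hmode' : forall e, exists f : R -> C, periodic f /\
        (forall t, HasDerivC f t
          (Ci * (s / (a, b) - nu) * f t + c t / (a, b) * Cconj (f t))%C) /\
        (forall r t, 0 < r -> (B j0 e * W j0 e r t = B j0 e * (Defs.Cpow r s * f t))%C)).
      { intros e; destruct (Req_dec (B j0 e) 0) as [Hz|Hz].
        - exists f0; split; [exact Pf0|]; split; [exact Df0|]; intros r t Hr.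
          rewrite Hz; ring.
        - destruct (Hmode j0 e Hz) as (f & Pf & _ & Df & Ef).
          exists f; split; [exact Pf|]; split; [exact Df|]; intros r t Hr.
          now rewrite Ef. }
      destruct (Hmode' true) as (f1 & P1 & D1 & E1).
      destruct (Hmode' false) as (f2 & P2 & D2 & E2).
      set (F := fun t => (B j0 true * f1 t + B j0 false * f2 t)%C).
      pose proof (real_linear_combination _ _ _ _ (B j0 true) (B j0 false) D1 D2) as DF.
      assert (EF : forall r t, 0 < r ->
        (B j0 true * W j0 true r t + B j0 false * W j0 false r t = Defs.Cpow r s * F t)%C).
      { intros r t Hr; rewrite E1, E2 by exact Hr; unfold F; ring. }
      destruct (positive_periodic_min (fun t => Cmod (F t))) as [m [Hm Hmin]].
      * intros t; unfold F; now rewrite P1, P2.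
      * apply Cmod_continuous, (HasDerivC_continuous _ _ DF).
      * intros t; apply Cmod_gt_0; intros Ht; apply Hnz; intros r t' Hr.
        rewrite EF by exact Hr.
        rewrite (real_linear_unique _ _ F G t HG DF Ht t'); ring.
      * exists m; split; [exact Hm|]; intros r t Hr.
        rewrite EF, Cmod_mult, Cmod_Cpow by exact Hr.
        rewrite Rmult_comm; apply Rmult_le_compat_l; [left; apply exp_pos | apply Hmin].
  - destruct (nonreal_mode a b nu c _ s Ha HB0 Hs) as (phi & q & Hp & Hr & Hq & _ & Hpos).
    assert (Hspan : forall j e, B j e <> 0 ->
      j = j0 /\ exists z, forall r t, 0 < r -> W j e r t = mode s phi q z r t).
    { intros j e Hne; destruct (HW j e) as [HBj Hwj]; rewrite (HB _ _ Hne) in HBj.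
      exact (nonreal_mode_span _ _ _ _ _ _ _ _ _ _ _ _ Ha Hs Hc Hper HG Hp Hr Hq Hw0 Hpos HBj Hwj). }
    split; [intros j e Hne; now apply (Hspan j e)|].
    (* Again the exponent is known only where the coefficient is nonzero; the amplitude [0] fills
       the other case. *)
    assert (Hspan' : forall e, exists z, forall r t, 0 < r ->
      (B j0 e * W j0 e r t = B j0 e * mode s phi q z r t)%C).
    { intros e; destruct (Req_dec (B j0 e) 0) as [Hz|Hz].
      - exists (RtoC 0); intros r t _; rewrite Hz; ring.
      - destruct (Hspan j0 e Hz) as [_ [z Ez]]; exists z; intros r t Hr0.
        now rewrite Ez. }
    destruct (Hspan' true) as [z1 E1]; destruct (Hspan' false) as [z2 E2].
    set (Z := (B j0 true * z1 + B j0 false * z2)%C).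
    assert (EF : forall r t, 0 < r ->
      (B j0 true * W j0 true r t + B j0 false * W j0 false r t)%C = mode s phi q Z r t).
    { intros r t Hr0; rewrite E1, E2 by exact Hr0; apply mode_combination. }
    assert (HZ : 0 < Cmod Z).
    { apply Cmod_gt_0; intros HZ; apply Hnz; intros r t Hr0.
      rewrite EF, HZ by exact Hr0; unfold mode.
      apply injective_projections; simpl; ring. }
    destruct (positive_periodic_min (fun t => Cmod (phi t) * (1 - Cmod (q t)))) as [m [Hm Hmin]].
    + intros t; now rewrite (profile_periodic _ _ _ _ _ Hp), (ratio_periodic _ _ _ _ _ Hp).
    + apply (continuity_mult (fun t => Cmod (phi t)) (fun t => 1 - Cmod (q t))).
      * apply Cmod_continuous, (HasDerivC_continuous _ _ (profile_derivative _ _ _ _ _ Hp)).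
      * apply (continuity_minus (fun _ => 1) (fun t => Cmod (q t))).
        { apply continuity_const; now intros ? ?. }
        apply Cmod_continuous, (ratio_continuous _ _ _ _ _ Hp).
    + intros t; apply Rmult_lt_0_compat.
      * apply Cmod_gt_0, (profile_nonzero _ _ _ _ _ Hp).
      * specialize (Hq t); lra.
    + exists (Cmod Z * m); split; [now apply Rmult_lt_0_compat|]; intros r t Hr0.
      rewrite EF by exact Hr0; eapply Rle_trans; [|apply mode_lower].
      rewrite Rmult_comm; apply Rmult_le_compat_l; [left; apply exp_pos|].
      apply Rmult_le_compat_l; [lra | apply Hmin].
Qed.

(** The two terms of a pair may nearly cancel at the reference point [(r0, 0)], so only their sum is
    usable there. Equality of exponents and ratios makes the pair a single mode, whose size at one
    point bounds its amplitude. The constant collects [2] from the upper bound, [2] from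
    [1 - |q| >= 1/2], and the Harnack factor. *)
Lemma large_pair_bound a b nu c G (w1 w2 : R -> R -> C) (s1 s2 : C) j :
  0 < a ->
  continuousC (fun t => c t / (a, b))%C -> periodic (fun t => c t / (a, b))%C ->
  (forall t, Cmod (c t / (a, b))%C <= G) ->
  IsBasic (a, b) nu c w1 s1 -> Winding (fun t => w1 1 t) j ->
  IsBasic (a, b) nu c w2 s2 -> Winding (fun t => w2 1 t) j ->
  snd s1 <> 0 -> snd s2 <> 0 ->
  2 * G * Cmod (2 * a / (a * a + b * b) * (a, b))%C + 4 * G
    < 2 * a / (a * a + b * b) * Rabs (snd s1) ->
  forall (x y : R) r r0 t, 0 < r -> 0 < r0 ->
    Cmod (x * w1 r t + y * w2 r t)%C <=
    4 * exp (4 * PI * G) * Rpower (r / r0) (fst s1) * Cmod (x * w1 r0 0%R + y * w2 r0 0%R)%C.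
Proof.
  intros Ha Hc Hper HG HB1 Hw1 HB2 Hw2 Hs1 Hs2 Hlarge x y r r0 t Hr Hr0.
  destruct (nonreal_mode a b nu c w1 s1 Ha HB1 Hs1) as (phi & q & Hp & Hric & Hq & Ew & Hpos).
  destruct (nonreal_mode a b nu c w2 s2 Ha HB2 Hs2) as (phi' & q' & Hp' & Hric' & Hq' & Ew' & Hpos').
  assert (HG0 : 0 <= G) by (eapply Rle_trans; [apply Cmod_ge_0 | apply (HG 0)]).
  assert (Hlam : ((a, b) : C) <> RtoC 0)
    by (intros E; apply (f_equal fst) in E; simpl in E; lra).
  set (th := (2 * a / (a * a + b * b) * (a, b))%C) in *.
  set (k1 := (2 * a / (a * a + b * b) * s1 - 2 * nu)%C) in *.
  set (k2 := (2 * a / (a * a + b * b) * s2 - 2 * nu)%C) in *.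
  assert (Hk1 : Rabs (Im k1) = 2 * a / (a * a + b * b) * Rabs (snd s1)).
  { replace (Im k1) with (2 * a / (a * a + b * b) * snd s1).
    2:{ unfold k1, Im; simpl; field; nra. }
    rewrite Rabs_mult, Rabs_pos_eq; [reflexivity|].
    left; apply Rdiv_lt_0_compat; nra. }
  rewrite <- Hk1 in Hlarge.
  assert (Hth : (k1 - k2 = th * (s1 / (a, b) - s2 / (a, b)))%C).
  { unfold k1, k2, th; generalize (2 * a / (a * a + b * b))%C; intros u.
    field; exact Hlam. }
  pose proof (Cmod_ge_0 th) as Hth0.
  destruct (profile_unique_large _ _ _ _ _ _ _ _ _ _ _ _ _ _ _ Hc Hper HG Hp Hp' Hric Hric' Hth
    Hw1 Hpos Hw2 Hpos') as [Emu Eq]; [nra|].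
  assert (Es : s2 = s1).
  { replace s2 with (s2 / (a, b) * (a, b))%C by (field; exact Hlam).
    rewrite <- Emu; field; exact Hlam. }
  rewrite <- Emu in Hp'.
  destruct (profile_proportional _ _ _ _ _ _ _ Hp Hp' (fun t => eq_sym (Eq t))) as [z Hz].
  destruct (mu_location _ _ _ _ _ _ _ _ Hc Hper HG Hp Hw1 Hpos) as [HIm _].
  pose proof (profile_harnack _ _ _ _ _ _ t Hc HG Hp HIm) as Hh.
  set (Z := (x * RtoC 1 + y * z)%C).
  assert (ET : forall r t, 0 < r -> (x * w1 r t + y * w2 r t)%C = mode s1 phi q Z r t).
  { intros r' t' Hr'; unfold Z; rewrite <- mode_combination, Ew, Ew' by exact Hr'.
    unfold mode; rewrite Es, Hz, <- Eq, Cmult_1_l; reflexivity. }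
  rewrite !ET by assumption.
  pose proof (riccati_small _ _ _ _ 0 Hric (ratio_periodic _ _ _ _ _ Hp)
                (ratio_le_1 _ _ _ _ _ Hp) HG) as Hsmall.
  (* [Hlarge] covers two thresholds: [2 G |th| + 2 G] for the contraction and [4 G] for this bound,
     which follows from [|Im k1| |q| <= 2 G]. *)
  assert (Hhalf : Cmod (q 0) <= / 2).
  { pose proof (Cmod_ge_0 (q 0)) as Hq0.
    assert (HI : 4 * G < Rabs (Im k1)) by nra.
    destruct (Rle_dec (Cmod (q 0)) (/ 2)) as [?|Hn]; [assumption|exfalso].
    assert (Rabs (Im k1) * / 2 <= Rabs (Im k1) * Cmod (q 0))
      by (apply Rmult_le_compat_l; [apply Rabs_pos | lra]).
    lra. }
  eapply Rle_trans; [apply mode_upper, (ratio_le_1 _ _ _ _ _ Hp)|].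
  pose proof (mode_lower s1 phi q Z r0 0) as Hlow.
  set (T0 := Cmod (mode s1 phi q Z r0 0)) in *.
  assert (Epow : Rpower r (fst s1) = Rpower (r / r0) (fst s1) * Rpower r0 (fst s1)).
  { rewrite Rpower_mult_distr by (try apply Rdiv_lt_0_compat; assumption).
    f_equal; field; lra. }
  assert (Hp0 : 0 < Rpower (r / r0) (fst s1)) by apply exp_pos.
  assert (Hp1 : 0 < Rpower r0 (fst s1)) by apply exp_pos.
  rewrite Epow.
  set (u := Rpower (r / r0) (fst s1)) in *; set (v := Rpower r0 (fst s1)) in *.
  pose proof (Cmod_ge_0 Z) as HZ; pose proof (Cmod_ge_0 (phi 0)) as Hphi0.
  pose proof (exp_pos (4 * PI * G)) as Hexp.
  assert (Hlow' : v * (Cmod Z * Cmod (phi 0)) <= 2 * T0).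
  { assert (v * (Cmod Z * (Cmod (phi 0) * / 2)) <= T0); [|lra].
    eapply Rle_trans; [|exact Hlow].
    repeat (apply Rmult_le_compat_l; [lra|]); lra. }
  apply Rle_trans with (2 * (u * v * (Cmod Z * (exp (4 * PI * G) * Cmod (phi 0))))).
  - apply Rmult_le_compat_l; [lra|]; apply Rmult_le_compat_l; [nra|].
    now apply Rmult_le_compat_l.
  - replace (2 * (u * v * (Cmod Z * (exp (4 * PI * G) * Cmod (phi 0)))))
      with (2 * exp (4 * PI * G) * u * (v * (Cmod Z * Cmod (phi 0)))) by ring.
    replace (4 * exp (4 * PI * G) * u * T0) with (2 * exp (4 * PI * G) * u * (2 * T0)) by ring.
    apply Rmult_le_compat_l; [|exact Hlow'].
    repeat apply Rmult_le_pos; lra.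
Qed.

(** * Asymptotic comparison at the origin *)

(** [delta] is uniform in [t], because the angles of the zeros are not controlled. *)
Definition little_o (rho : R) (F : R -> R -> C) : Prop :=
  forall eps, 0 < eps -> exists delta, 0 < delta /\
    forall r t, 0 < r < delta -> Cmod (F r t) <= eps * Rpower r rho.

Lemma little_o_plus rho F1 F2 :
  little_o rho F1 -> little_o rho F2 -> little_o rho (fun r t => F1 r t + F2 r t)%C.
Proof.
  intros H1 H2 eps He.
  destruct (H1 (eps / 2)) as [d1 [Hd1 B1]]; [lra|].
  destruct (H2 (eps / 2)) as [d2 [Hd2 B2]]; [lra|].
  exists (Rmin d1 d2); split; [now apply Rmin_glb_lt|]; intros r t Hr.
  pose proof (Rmin_l d1 d2); pose proof (Rmin_r d1 d2).
  specialize (B1 r t ltac:(lra)); specialize (B2 r t ltac:(lra)).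
  eapply Rle_trans; [apply Cmod_triangle|]; lra.
Qed.

Lemma little_o_power rho rho' K R0 F :
  rho < rho' -> 0 < R0 ->
  (forall r t, 0 < r < R0 -> Cmod (F r t) <= K * Rpower r rho') -> little_o rho F.
Proof.
  intros Hrho HR0 HF eps He.
  set (eta := rho' - rho); assert (Heta : 0 < eta) by (unfold eta; lra).
  (* [K] may be zero or negative; [K' >= 1] makes [eps / K'] positive, and
     [Rpower (eps / K') (/ eta)] is the radius where [K' r^eta = eps]. *)
  set (K' := Rmax K 1); assert (HK' : 1 <= K') by apply Rmax_r.
  assert (Hy : 0 < eps / K') by (apply Rdiv_lt_0_compat; lra).
  exists (Rmin R0 (Rpower (eps / K') (/ eta))); split.
  { apply Rmin_glb_lt; [exact HR0 | apply exp_pos]. }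
  intros r t Hr.
  pose proof (Rmin_l R0 (Rpower (eps / K') (/ eta))).
  pose proof (Rmin_r R0 (Rpower (eps / K') (/ eta))).
  eapply Rle_trans; [apply HF; lra|].
  replace rho' with (eta + rho) by (unfold eta; ring).
  rewrite Rpower_plus, <- Rmult_assoc.
  apply Rmult_le_compat_r; [left; apply exp_pos|].
  assert (Hp : Rpower r eta <= eps / K').
  { replace (eps / K') with (Rpower (Rpower (eps / K') (/ eta)) eta).
    - apply Rle_Rpower_l; lra.
    - rewrite Rpower_mult, Rinv_l, Rpower_1; lra. }
  assert (0 < Rpower r eta) by apply exp_pos.
  pose proof (Rmax_l K 1) as HKK'; fold K' in HKK'.
  apply Rle_trans with (K' * Rpower r eta); [apply Rmult_le_compat_r; lra|].
  apply Rle_trans with (K' * (eps / K')); [apply Rmult_le_compat_l; lra|].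
  right; field; lra.
Qed.

(** * Symmetric partial sums and minimal exponents *)

Ltac Cring := match goal with |- @eq _ ?x ?y => change (@eq C x y); ring end.

Lemma SymSum_succ (T : Z -> C) n :
  SymSum T (S n) = (SymSum T n + (T (Z.of_nat (S n)) + T (- Z.of_nat (S n))%Z))%C.
Proof. reflexivity. Qed.

Lemma SymSum_plus (T1 T2 : Z -> C) n :
  SymSum (fun j => T1 j + T2 j)%C n = (SymSum T1 n + SymSum T2 n)%C.
Proof.
  induction n as [|n IH]; [reflexivity|].
  rewrite !SymSum_succ, IH; Cring.
Qed.

Lemma SymSum_zero (T : Z -> C) n :
  (forall j, (Z.abs j <= Z.of_nat n)%Z -> T j = RtoC 0) -> SymSum T n = RtoC 0.
Proof.
  induction n as [|n IH]; intros H.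
  - apply H; simpl; lia.
  - rewrite SymSum_succ, IH, !H by (intros; try apply H; lia); Cring.
Qed.

Lemma SymSum_single (T : Z -> C) j0 n :
  (forall j, j <> j0 -> T j = RtoC 0) -> (Z.abs j0 <= Z.of_nat n)%Z ->
  SymSum T n = T j0.
Proof.
  intros H; induction n as [|n IH]; intros Hn.
  - replace j0 with 0%Z by (simpl in Hn; lia); reflexivity.
  - rewrite SymSum_succ.
    destruct (Z_le_gt_dec (Z.abs j0) (Z.of_nat n)) as [Hle|Hgt].
    + rewrite IH by exact Hle.
      rewrite (H (Z.of_nat (S n))), (H (- Z.of_nat (S n))%Z) by lia; Cring.
    + rewrite SymSum_zero by (intros j Hj; apply H; lia).
      destruct (Z.eq_dec j0 (Z.of_nat (S n))) as [->|Hne].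
      * rewrite (H (- Z.of_nat (S n))%Z) by lia; Cring.
      * replace j0 with (- Z.of_nat (S n))%Z by lia.
        rewrite (H (Z.of_nat (S n))) by lia; Cring.
Qed.

Lemma SymSum_little_o rho (F : Z -> R -> R -> C) n :
  (forall j, little_o rho (F j)) ->
  little_o rho (fun r t => SymSum (fun j => F j r t) n).
Proof.
  intros H; induction n as [|n IH]; [apply H|].
  change (little_o rho (fun r t => SymSum (fun j => F j r t) n
    + (F (Z.of_nat (S n)) r t + F (- Z.of_nat (S n))%Z r t))%C).
  apply little_o_plus; [exact IH | apply little_o_plus; apply H].
Qed.

Lemma list_argmin {X : Type} (P : X -> Prop) (f : X -> R) (l : list X) :
  (exists x, In x l /\ P x) ->
  exists x, P x /\ forall y, In y l -> P y -> f x <= f y.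
Proof.
  induction l as [|z l IH]; intros [x [Hx HP]]; [destruct Hx|].
  destruct (classic (exists x, In x l /\ P x)) as [Hl|Hl].
  - destruct (IH Hl) as [x' [HP' Hmin]].
    destruct (classic (P z /\ f z < f x')) as [[Pz Hz]|Hz].
    + exists z; split; [exact Pz|]; intros y [<-|Hy] Py; [lra|].
      specialize (Hmin y Hy Py); lra.
    + exists x'; split; [exact HP'|]; intros y [<-|Hy] Py; [|auto].
      destruct (Rle_dec (f x') (f z)); [assumption|].
      exfalso; apply Hz; split; [assumption|lra].
  - exists x; split; [exact HP|]; intros y [<-|Hy] Py.
    + destruct Hx as [<-|Hx]; [lra|exfalso; apply Hl; now exists x].
    + exfalso; apply Hl; now exists y.
Qed.

(** Properness leaves finitely many candidates below the level of one known element, and a minimum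
    over a finite box containing them is global. *)
Lemma proper_argmin (P : Z -> bool -> Prop) (f : Z -> bool -> R) :
  (forall x : R, exists N : nat, forall j e, P j e -> f j e <= x -> (Z.abs j <= Z.of_nat N)%Z) ->
  (exists j e, P j e) ->
  exists j e, P j e /\ forall j' e', P j' e' -> f j e <= f j' e'.
Proof.
  intros Hprop [j1 [e1 H1]].
  destruct (Hprop (f j1 e1)) as [N HN].
  set (l := flat_map (fun n : nat => (Z.of_nat n, true) :: (Z.of_nat n, false)
      :: ((- Z.of_nat n)%Z, true) :: ((- Z.of_nat n)%Z, false) :: nil) (seq 0 (S N))).
  assert (Hl : forall j e, (Z.abs j <= Z.of_nat N)%Z -> In (j, e) l).
  { intros j e Hj; unfold l; apply in_flat_map.
    exists (Z.to_nat (Z.abs j)); split; [apply in_seq; lia|].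
    rewrite Z2Nat.id by lia; simpl.
    destruct (Z_le_gt_dec 0 j).
    - rewrite Z.abs_eq by lia; destruct e; auto.
    - rewrite Z.abs_neq, Z.opp_involutive by lia; destruct e; auto. }
  destruct (list_argmin (fun p => P (fst p) (snd p)) (fun p => f (fst p) (snd p)) l)
    as [[j e] [HP Hmin]].
  { exists (j1, e1); split; [apply Hl, (HN _ e1); auto; lra | exact H1]. }
  simpl in *; exists j, e; split; [exact HP|]; intros j' e' HP'.
  pose proof (Hmin (j1, e1) (Hl _ _ (HN _ _ H1 ltac:(lra))) H1) as Hm1; simpl in Hm1.
  destruct (Rle_dec (f j' e') (f j1 e1)) as [Hle|Hle].
  - exact (Hmin (j', e') (Hl _ _ (HN _ _ HP' Hle)) HP').
  - lra.
Qed.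

Lemma SymSum_tail (T : Z -> C) (u : C) (Q q : R) (N : nat) :
  0 <= Q -> 0 <= q < 1 ->
  (forall i, Cmod (T (Z.of_nat (N + S i)) + T (- Z.of_nat (N + S i))%Z)%C <= Q * q ^ S i) ->
  (forall eps, 0 < eps -> exists N0, forall n, (N0 <= n)%nat ->
     Cmod (SymSum T n - u)%C < eps) ->
  Cmod (u - SymSum T N)%C <= Q / (1 - q).
Proof.
  intros HQ Hq HT Hlim.
  (* The right side is the geometric sum from exponent [0], while the terms start with exponent [1];
     the surplus [Q] only costs a constant. *)
  assert (Hd : forall d, Cmod (SymSum T (N + d) - SymSum T N)%C
                         <= Q * (1 - q ^ S d) / (1 - q)).
  { induction d as [|d IH].
    - rewrite Nat.add_0_r.
      replace (SymSum T N - SymSum T N)%C with (RtoC 0)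
        by (apply injective_projections; simpl; ring).
      rewrite Cmod_0; replace (Q * (1 - q ^ 1) / (1 - q)) with Q by (simpl; field; lra).
      exact HQ.
    - specialize (HT d).
      replace (N + S d)%nat with (S (N + d)) in * by lia.
      rewrite SymSum_succ.
      set (z := (T (Z.of_nat (S (N + d))) + T (- Z.of_nat (S (N + d)))%Z)%C) in *.
      set (y := SymSum T (N + d)) in *; set (x := SymSum T N) in *.
      replace (y + z - x)%C with ((y - x) + z)%C
        by (apply injective_projections; simpl; ring).
      eapply Rle_trans; [apply Cmod_triangle|].
      replace (Q * (1 - q ^ S (S d)) / (1 - q))
        with (Q * (1 - q ^ S d) / (1 - q) + Q * q ^ S d) by (simpl; field; lra).
      lra. }
  apply le_epsilon; intros eps He.
  destruct (Hlim eps He) as [N0 HN0].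
  specialize (HN0 (N + N0)%nat ltac:(lia)); specialize (Hd N0).
  assert (Hb : Q * (1 - q ^ S N0) / (1 - q) <= Q / (1 - q)).
  { unfold Rdiv; apply Rmult_le_compat_r; [left; apply Rinv_0_lt_compat; lra|].
    assert (0 <= q ^ S N0) by (apply pow_le; lra); nra. }
  set (y := SymSum T (N + N0)) in *; set (x := SymSum T N) in *.
  replace (u - x)%C with ((y - x) + - (y - u))%C
    by (apply injective_projections; simpl; ring).
  eapply Rle_trans; [apply Cmod_triangle|]; rewrite Cmod_opp; lra.
Qed.

(** * Decay of the Laurent tail *)

Lemma CkC_continuous k c : (2 <= k)%nat -> CkC k c -> continuousC c.
Proof.
  assert (H : forall f, (2 <= k)%nat -> CkR k f -> continuity f).
  { intros f Hk [D [H0 [HD _]]].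
    intros x; apply (continuity_pt_ext (D 0%nat)); [exact H0|].
    apply derivable_continuous_pt; exists (D 1%nat x); apply HD; lia. }
  intros Hk [H1 H2]; split; apply H; assumption.
Qed.

Lemma Rpower_antitone x y z : 0 < x <= 1 -> y <= z -> Rpower x z <= Rpower x y.
Proof.
  intros Hx Hyz; unfold Rpower.
  assert (Hln : ln x <= 0).
  { rewrite <- ln_1; destruct (Req_dec x 1) as [->|Hne]; [lra|].
    left; apply ln_increasing; lra. }
  assert (H : z * ln x <= y * ln x) by nra.
  destruct H as [H|H]; [left; now apply exp_increasing | right; now rewrite H].
Qed.

(* Boundedness of the terms at the single point [(Rad / 2, 0)] propagates, by
   [large_pair_bound], to geometric decay of the series near [r = 0]. *)
Lemma laurent_tail a b nu c G Rad u W (Sg : Z -> bool -> C) (A : Z -> bool -> R) s0 :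
  0 < a -> b <> 0 -> 0 <= nu < 1 -> 0 < Rad ->
  continuousC (fun t => c t / (a, b))%C -> periodic (fun t => c t / (a, b))%C ->
  (forall t, Cmod (c t / (a, b))%C <= G) ->
  (forall j e, IsBasic (a, b) nu c (W j e) (Sg j e) /\ Winding (fun t => W j e 1 t) j) ->
  (forall r t, 0 < r < Rad -> forall eps, 0 < eps -> exists N0, forall N, (N0 <= N)%nat ->
     Cmod (SymSum (fun j => A j true * W j true r t + A j false * W j false r t)%C N
           - u r t)%C < eps) ->
  (forall j e, fst (Sg j e) < s0 -> A j e = 0) ->
  forall rho, exists N0, forall N, (N0 <= N)%nat ->
    little_o rho (fun r t => u r t -
      SymSum (fun j => A j true * W j true r t + A j false * W j false r t)%C N)%C.
Proof.
  intros Ha Hb Hnu HRad Hc Hper HG HW Hlim HA rho.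
  assert (HG0 : 0 <= G) by (eapply Rle_trans; [apply Cmod_ge_0 | apply (HG 0)]).
  set (C1 := (a + Rabs b) * G).
  assert (Hloc : forall j e, Rabs (fst (Sg j e) - a * (nu + IZR j)) <= C1 /\
                             Rabs (snd (Sg j e) - b * (nu + IZR j)) <= C1).
  { intros j e; destruct (HW j e) as [HB Hw].
    exact (proj2 (exponent_location _ _ _ _ _ _ _ _ Ha HB Hw Hc Hper HG)). }
  set (k2 := 2 * a / (a * a + b * b)).
  assert (Hk2 : 0 < k2) by (apply Rdiv_lt_0_compat; nra).
  set (M0 := 2 * G * Cmod (2 * a / (a * a + b * b) * (a, b))%C + 4 * G).
  assert (HM0 : 0 <= M0).
  { unfold M0; pose proof (Cmod_ge_0 (2 * a / (a * a + b * b) * (a, b))%C); nra. }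
  set (M := M0 / k2).
  assert (HM : 0 <= M).
  { unfold M, Rdiv; apply Rmult_le_pos; [exact HM0|left; now apply Rinv_0_lt_compat]. }
  set (T := fun r t j => (A j true * W j true r t + A j false * W j false r t)%C).
  change (forall r t, 0 < r < Rad -> forall eps, 0 < eps -> exists N0, forall N,
    (N0 <= N)%nat -> Cmod (SymSum (T r t) N - u r t)%C < eps) in Hlim.
  set (r0 := Rad / 2).
  assert (Hr0 : 0 < r0 < Rad) by (unfold r0; lra).
  destruct (Hlim r0 0 Hr0 1 Rlt_0_1) as [n0 Hn0].
  pose proof (Rabs_pos_lt b Hb) as Hb0.
  assert (Hbig : forall x y, 0 < y -> exists n, forall k, (n <= k)%nat -> x < y * INR k).
  { intros x y Hy; destruct (INR_unbounded (x / y)) as [n Hn]; exists n; intros k Hk.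
    apply le_INR in Hk; apply (Rmult_lt_compat_l y) in Hn; [|exact Hy].
    replace (y * (x / y)) with x in Hn by (field; lra); nra. }
  (* Beyond [n1] the exponents of positive index are non-real and in the contraction regime; beyond
     [n2] finite order removes the negative indices, the extra [a] absorbing [a * nu]; beyond [n3]
     the real parts of positive index exceed [rho]. *)
  destruct (Hbig (C1 + M) (Rabs b) Hb0) as [n1 Hn1].
  destruct (Hbig (C1 + a - s0) a Ha) as [n2 Hn2].
  destruct (Hbig (C1 + rho) a Ha) as [n3 Hn3].
  exists (n0 + n1 + n2 + n3)%nat; intros N HN.
  change (little_o rho (fun r t => u r t - SymSum (T r t) N)%C).
  assert (Hneg : forall k r t, (N <= k)%nat -> T r t (- Z.of_nat k)%Z = RtoC 0).
  { intros k r t Hk.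
    assert (HAz : forall e, A (- Z.of_nat k)%Z e = 0).
    { intros e; apply HA; destruct (Hloc (- Z.of_nat k)%Z e) as [H1 _].
      rewrite opp_IZR, <- INR_IZR_INZ in H1; apply Rabs_le_between in H1.
      specialize (Hn2 k ltac:(lia)); nra. }
    unfold T; rewrite !HAz; ring. }
  assert (Hpos : forall k e, (N <= k)%nat ->
    M < Rabs (snd (Sg (Z.of_nat k) e)) /\ a * INR k - C1 <= fst (Sg (Z.of_nat k) e)).
  { intros k e Hk; destruct (Hloc (Z.of_nat k) e) as [H1 H2].
    rewrite <- INR_IZR_INZ in H1, H2; apply Rabs_le_between in H1.
    split; [|nra].
    specialize (Hn1 k ltac:(lia)).
    assert (H3 : Rabs b * INR k <= Rabs (b * (nu + INR k))).
    { rewrite Rabs_mult, (Rabs_pos_eq (nu + INR k)) by (pose proof (pos_INR k); lra); nra. }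
    pose proof (Rabs_triang_inv (b * (nu + INR k)) (snd (Sg (Z.of_nat k) e))) as H4.
    rewrite Rabs_minus_sym in H4; lra. }
  (* Two consecutive partial sums both lie within [1] of [u r0 0], and the negative index
     contributes nothing, so their difference is the single pair of index [S k]. *)
  assert (HT0 : forall k, (N <= k)%nat -> Cmod (T r0 0 (Z.of_nat (S k))) <= 2).
  { intros k Hk.
    pose proof (Hn0 k ltac:(lia)) as H1; pose proof (Hn0 (S k) ltac:(lia)) as H2.
    rewrite SymSum_succ, Hneg in H2 by lia.
    set (x := T r0 0 (Z.of_nat (S k))) in *; set (y := SymSum (T r0 0) k) in *.
    pose proof (Cmod_triangle (y + (x + 0) - u r0 0%R) (- (y - u r0 0%R)))%C as H3.
    rewrite Cmod_opp in H3.
    replace (y + (x + 0) - u r0 0%R + - (y - u r0 0%R))%C with x in H3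
      by (apply injective_projections; simpl; ring).
    lra. }
  (* For [r < r0 / 2] the ratio [r / r0] is at most [1 / 2], and each step in the index raises the
     lower bound of the exponent by [a]; hence this common ratio. *)
  set (q := Rpower (/ 2) a).
  assert (Hq : 0 < q < 1).
  { split; [apply exp_pos|]; unfold q.
    replace 1 with (Rpower 1 a) by (unfold Rpower; rewrite ln_1, Rmult_0_r; apply exp_0).
    apply Rlt_Rpower_l; lra. }
  set (Ce := 4 * exp (4 * PI * G)).
  assert (HCe : 0 < Ce) by (unfold Ce; pose proof (exp_pos (4 * PI * G)); lra).
  set (E := a * INR N - C1).
  apply (little_o_power rho E (Ce * 2 * Rpower (/ r0) E / (1 - q)) (r0 / 2)).
  { unfold E; specialize (Hn3 N ltac:(lia)); lra. }
  { lra. }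
  intros r t Hr.
  set (x := r / r0).
  assert (Hx : 0 < x <= / 2).
  { unfold x; split; [apply Rdiv_lt_0_compat; lra|].
    apply (Rmult_le_reg_r r0); [lra|]; unfold Rdiv.
    rewrite Rmult_assoc, Rinv_l; lra. }
  replace (Ce * 2 * Rpower (/ r0) E / (1 - q) * Rpower r E)
    with (Ce * 2 * Rpower x E / (1 - q)).
  2:{ unfold x, Rdiv at 2.
      rewrite <- Rpower_mult_distr by (try apply Rinv_0_lt_compat; lra); field; lra. }
  apply SymSum_tail; [| lra | | apply Hlim; lra].
  { assert (0 < Rpower x E) by apply exp_pos; nra. }
  intros i; rewrite Hneg, Cplus_0_r by lia.
  set (k := (N + S i)%nat).
  destruct (Hpos k true ltac:(lia)) as [Him Hre].
  destruct (Hpos k false ltac:(lia)) as [Him' _].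
  destruct (HW (Z.of_nat k) true) as [HB1 Hw1].
  destruct (HW (Z.of_nat k) false) as [HB2 Hw2].
  assert (Hs : forall z : R, M < Rabs z -> z <> 0) by (intros z Hz ->; rewrite Rabs_R0 in Hz; lra).
  eapply Rle_trans.
  { apply (large_pair_bound a b nu c G _ _ _ _ _ Ha Hc Hper HG HB1 Hw1 HB2 Hw2
             (Hs _ Him) (Hs _ Him')) with (r0 := r0); [|lra|lra].
    fold M0 k2; apply (Rmult_lt_compat_l k2) in Him; [|exact Hk2].
    unfold M in Him; replace (k2 * (M0 / k2)) with M0 in Him by (field; lra); exact Him. }
  fold Ce x.
  pose proof (HT0 (N + i)%nat ltac:(lia)) as HT.
  replace (S (N + i)) with k in HT by (unfold k; lia).
  unfold T in HT.
  (* Since [x <= 1], the real part of the exponent may be replaced by its lower bound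
     [E + a * INR (S i)], which yields a geometric term in [i]. *)
  apply Rle_trans with (Ce * Rpower x (a * INR k - C1) * 2).
  { assert (0 < Rpower x (fst (Sg (Z.of_nat k) true))) by apply exp_pos.
    apply Rmult_le_compat; auto using Cmod_ge_0.
    - apply Rmult_le_pos; lra.
    - apply Rmult_le_compat_l; [lra|]; apply Rpower_antitone; [lra|exact Hre]. }
  replace (a * INR k - C1) with (E + a * INR (S i)) by (unfold k, E; rewrite plus_INR; ring).
  rewrite Rpower_plus, <- Rpower_mult, Rpower_pow by apply exp_pos.
  replace (Ce * (Rpower x E * Rpower x a ^ S i) * 2) with (Ce * 2 * Rpower x E * Rpower x a ^ S i)
    by ring.
  apply Rmult_le_compat_l.
  { assert (0 < Rpower x E) by apply exp_pos; nra. }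
  apply pow_incr; split; [left; apply exp_pos|].
  unfold q; apply Rle_Rpower_l; lra.
Qed.

(** * The leading exponent against the remainder *)

Lemma SymSum_ext (T1 T2 : Z -> C) n :
  (forall j, T1 j = T2 j) -> SymSum T1 n = SymSum T2 n.
Proof.
  intros H; induction n as [|n IH]; [apply H|].
  now rewrite !SymSum_succ, IH, !H.
Qed.

Lemma real_combination_Cx (x y : R) (z w : Cx) :
  Cadd (Cscal x z) (Cscal y w) = (x * z + y * w)%C.
Proof. apply injective_projections; simpl; ring. Qed.

Lemma dominated_leading_term (u L E : R -> R -> C) rho m Rad (rk tk : nat -> R) :
  0 < m ->
  (forall r t, 0 < r -> m * Rpower r rho <= Cmod (L r t)) -> little_o rho E ->
  (forall r t, 0 < r < Rad -> u r t = (L r t + E r t)%C) ->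
  (forall n, 0 < rk n < Rad) -> Un_cv rk 0 -> ~ (forall n, u (rk n) (tk n) = RtoC 0).
Proof.
  intros Hm HL HE Hu Hrk Hcv Hz.
  destruct (HE (m / 2)) as [d [Hd HEd]]; [lra|].
  destruct (Hcv d Hd) as [n Hn]; specialize (Hn n (Nat.le_refl n)).
  unfold Rdist in Hn; rewrite Rminus_0_r in Hn.
  destruct (Hrk n) as [Hr1 Hr2]; rewrite Rabs_pos_eq in Hn by lra.
  specialize (HL (rk n) (tk n) Hr1); specialize (HEd (rk n) (tk n) (conj Hr1 Hn)).
  assert (Hp : 0 < Rpower (rk n) rho) by apply exp_pos.
  specialize (Hz n); rewrite Hu in Hz by auto.
  replace (L (rk n) (tk n)) with (L (rk n) (tk n) + E (rk n) (tk n) - E (rk n) (tk n))%C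
    in HL by ring.
  rewrite Hz in HL; unfold Cminus in HL; rewrite Cplus_0_l, Cmod_opp in HL; nra.
Qed.

Theorem theorem6p6 :
  forall (a b nu : R) (k : nat) (c : R -> Cx) (Rad : R) (u : R -> R -> Cx),
    0 < a -> b <> 0 -> 0 <= nu < 1 -> (2 <= k)%nat ->
    Periodic c -> CkC k c -> 0 < Rad ->
    (forall s s' : Cx, InSpec (a, b) nu c s -> InSpec (a, b) nu c s' ->
        fst s = fst s' -> s = s') ->
    IsSolution (a, b) nu c (fun r => 0 < r < Rad) u ->
    FiniteOrder (a, b) nu c Rad u ->
    (exists rk tk : nat -> R,
        (forall n, 0 < rk n < Rad) /\ Un_cv rk 0 /\ (forall n, u (rk n) (tk n) = C0)) ->
    forall r t, 0 < r < Rad -> u r t = C0.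
Proof.
  intros a b nu k c Rad u Ha Hb Hnu Hk Hper Hck HRad Hspec _
    (W & Sg & A & s0 & HW & Hind & Hlim & HA) (rk & tk & Hrk & Hcv & Hzero).
  assert (Hind' : forall j (al be : R),
     (forall r t, 0 < r -> (al * W j true r t + be * W j false r t = 0)%C) ->
     al = 0 /\ be = 0).
  { intros j al be H; apply (Hind j); intros r t Hr.
    rewrite real_combination_Cx; now apply H. }
  assert (Hlim' : forall r t, 0 < r < Rad -> forall eps, 0 < eps ->
     exists N0, forall N, (N0 <= N)%nat ->
     Cmod (SymSum (fun j => A j true * W j true r t + A j false * W j false r t)%C N
           - u r t)%C < eps).
  { intros r t Hr eps He; destruct (Hlim r t Hr eps He) as [N0 HN0].
    exists N0; intros N HN; specialize (HN0 N HN); rewrite Cnorm_Cmod in HN0.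
    rewrite (SymSum_ext _ (fun j => A j true * W j true r t + A j false * W j false r t)%C) in HN0;
      [exact HN0 | intros j; apply real_combination_Cx]. }
  set (h := fun t => (c t / (a, b))%C).
  assert (Hc : continuousC h).
  { apply (continuousC_mult c (fun _ => / (a, b))%C);
      [now apply (CkC_continuous k) | apply continuousC_const]. }
  assert (Hph : periodic h) by (intros t; unfold h; now rewrite Hper).
  destruct (periodic_bounded h Hph Hc) as [G [HG0 HG]].
  destruct (classic (exists j e, A j e <> 0)) as [Hex|Hnone].
  2:{ intros r t Hr; apply Cmod_eq_0.
      apply Rle_antisym; [|apply Cmod_ge_0].
      apply le_epsilon; intros eps He; rewrite Rplus_0_l.
      destruct (Hlim' r t Hr eps He) as [N HN]; specialize (HN N (Nat.le_refl N)).
      rewrite SymSum_zero in HN.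
      - replace (RtoC 0 - u r t)%C with (- u r t)%C in HN
          by (apply injective_projections; simpl; ring).
        rewrite Cmod_opp in HN; lra.
      - intros j _.
        assert (HAz : forall e, A j e = 0).
        { intros e; apply NNPP; intros Hne; apply Hnone; now exists j, e. }
        rewrite !HAz; ring. }
  exfalso.
  assert (Hloc : forall j e, Rabs (fst (Sg j e) - a * (nu + IZR j)) <= (a + Rabs b) * G).
  { intros j e; destruct (HW j e) as [HB Hw].
    apply (exponent_location _ _ _ _ _ _ _ _ Ha HB Hw Hc Hph HG). }
  destruct (proper_argmin (fun j e => A j e <> 0) (fun j e => fst (Sg j e)))
    as (j0 & e0 & HA0 & Hmin); [|exact Hex|].
  { intros x.
    (* The level [x] limits [j] from above, finite order through [s0] limits it from below, and the
       summand [1] absorbs [nu < 1]. *)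
    destruct (INR_unbounded ((Rmax x (- s0) + (a + Rabs b) * G) / a + 1)) as [N HN].
    exists N; intros j e Hne Hle.
    assert (Hs0 : s0 <= fst (Sg j e)).
    { destruct (Rle_dec s0 (fst (Sg j e))); [assumption|].
      exfalso; apply Hne, HA; lra. }
    specialize (Hloc j e); apply Rabs_le_between in Hloc.
    pose proof (Rmax_l x (- s0)); pose proof (Rmax_r x (- s0)).
    assert (HN' : Rmax x (- s0) + (a + Rabs b) * G + a < a * INR N).
    { apply (Rmult_lt_compat_l a) in HN; [|exact Ha].
      replace (a * ((Rmax x (- s0) + (a + Rabs b) * G) / a + 1))
        with (Rmax x (- s0) + (a + Rabs b) * G + a) in HN by (field; lra); exact HN. }
    rewrite INR_IZR_INZ in HN'.
    assert (H1 : IZR j < IZR (Z.of_nat N)) by nra.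
    assert (H2 : IZR (- Z.of_nat N) < IZR j) by (rewrite opp_IZR; nra).
    apply lt_IZR in H1; apply lt_IZR in H2; lia. }
  set (s := Sg j0 e0) in *.
  set (B := fun j e => if excluded_middle_informative (Sg j e = s) then A j e else 0).
  assert (HBs : forall j e, B j e <> 0 -> Sg j e = s).
  { intros j e; unfold B; destruct (excluded_middle_informative _); [auto | intros H; now destruct H]. }
  assert (HB0 : B j0 e0 <> 0).
  { unfold B; destruct (excluded_middle_informative _) as [_|Hn]; [exact HA0 | now destruct Hn]. }
  destruct (leading_term a b nu c G W Sg B s j0 e0 Ha Hc Hph HG HW Hind' HBs HB0)
    as [Hj0 [m [Hm Hlead]]].
  destruct (laurent_tail a b nu c G Rad u W Sg A s0 Ha Hb Hnu HRad Hc Hph HG HW Hlim' HA (fst s))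
    as [N0 HN0].
  (* [N0] serves the tail; adding [|j0|] places the leading pair inside the partial sum. *)
  set (N := (N0 + Z.to_nat (Z.abs j0))%nat).
  (* The spectral hypothesis acts here: a remaining term has an exponent other than [s] and, by
     minimality, real part at least [fst s]. Equal real parts would give equal exponents, so the
     inequality is strict. *)
  assert (Hrest1 : forall j e, little_o (fst s) (fun r t => RtoC (A j e - B j e) * W j e r t)%C).
  { intros j e.
    destruct (HW j e) as [HB Hw].
    destruct (basic_growth _ _ _ _ _ _ _ Ha HB Hw) as [K [HK HKb]].
    destruct (Req_dec (A j e - B j e) 0) as [Hz|Hnz].
    (* A vanishing coefficient is treated apart, because the exponent of its basic solution may have
       real part below [fst s]; any power above [fst s] works. *)
    - apply (little_o_power _ (fst s + 1) 0 1); [lra|lra|]; intros r t _.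
      rewrite Hz, Cmult_0_l, Cmod_0; lra.
    - apply (little_o_power _ (fst (Sg j e)) (Rabs (A j e - B j e) * K) 1); [|lra|].
      + assert (HAne : A j e <> 0 /\ Sg j e <> s).
        { unfold B in Hnz; destruct (excluded_middle_informative (Sg j e = s)) as [|Hn];
            [exfalso; lra | split; [lra | exact Hn]]. }
        destruct HAne as [HAne Hsne]; specialize (Hmin j e HAne); cbv beta in Hmin.
        destruct Hmin as [Hlt|Heq]; [exact Hlt | exfalso; apply Hsne; symmetry].
        apply Hspec; [| | exact Heq].
        * exists (W j0 e0); apply HW.
        * exists (W j e); exact HB.
      + intros r t Hr; rewrite Cmod_mult, Cmod_R, Rmult_assoc.
        apply Rmult_le_compat_l; [apply Rabs_pos | apply HKb; lra]. }
  set (D := fun j r t => (RtoC (A j true - B j true) * W j true r t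
                          + RtoC (A j false - B j false) * W j false r t)%C).
  set (F := fun j r t => (B j true * W j true r t + B j false * W j false r t)%C).
  set (S1 := fun r t => SymSum
    (fun j => A j true * W j true r t + A j false * W j false r t)%C N).
  assert (HD : little_o (fst s) (fun r t => SymSum (fun j => D j r t) N)).
  { apply SymSum_little_o; intros j; apply little_o_plus; apply Hrest1. }
  assert (HS : forall r t, S1 r t = (F j0 r t + SymSum (fun j => D j r t) N)%C).
  { intros r t; unfold S1.
    rewrite <- (SymSum_single (fun j => F j r t) j0 N).
    - rewrite <- SymSum_plus; apply SymSum_ext; intros j.
      unfold F, D; rewrite !RtoC_minus; ring.
    - intros j Hj.
      assert (HBz : forall e, B j e = 0).
      { intros e; apply NNPP; intros Hne; now apply Hj, (Hj0 j e). }
      unfold F; rewrite !HBz; ring.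
    - unfold N; lia. }
  apply (dominated_leading_term u (F j0)
    (fun r t => SymSum (fun j => D j r t) N + (u r t - S1 r t))%C (fst s) m Rad rk tk);
    auto.
  - apply little_o_plus; [exact HD | apply HN0; unfold N; lia].
  - intros r t _; rewrite HS.
    apply injective_projections; simpl; ring.
Qed.
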